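(* Suppose the EEC computation type $\underline R$ is either (i) a computation-type constant different from $\underline\alpha$ for every simply-typed $\lambda$-calculus type constant $\alpha$, or (ii) the type $\underline I$. Then: (1) If $\Theta\vdash M:\tau$, $\Theta\vdash N:\tau$ and $\Theta^{ln}\multimap\underline R\mid-\vdash M^{ln}=N^{ln}:\tau^{ln}\multimap\underline R$ in EEC, then $\Theta\vdash M=_{\beta\eta}N:\tau$. (2) If $\Theta^{ln}\multimap\underline R\mid-\vdash t:\tau^{ln}\multimap\underline R$ is an EEC term, then there exists a simply-typed term $\Theta\vdash M:\tau$ such that $\Theta^{ln}\multimap\underline R\mid-\vdash M^{ln}=t:\tau^{ln}\multimap\underline R$.
   Context: **EEC (enriched effect calculus).** There are value-type constants $\alpha,\beta,\ldots$ and a disjoint set of computation-type constants $\underline{\alpha},\underline{\beta},\ldots$. Value types $A,B,C$ and computation types $\underline{A},\underline{B},\underline{C},\underline{D}$ are generated by $A::=\alpha\mid 1\mid A\times B\mid A\to B\mid \underline{A}\mid \underline{A}\multimap\underline{B}$ and $\underline{A}::=\underline{\alpha}\mid\underline{1}\mid\underline{A}\,\&\,\underline{B}\mid A\Rightarrow\underline{B}\mid\underline{I}\mid\ !A\mid\ !A\otimes\underline{B}\mid\underline{0}\mid\underline{A}\oplus\underline{B}$ (every computation type is also a value type; $!A\otimes\underline{B}$ is one primitive binary constructor). Judgements are $\Gamma\mid -\vdash t:A$ and $\Gamma\mid z{:}\underline{A}\vdash t:\underline{B}$, where $\Gamma$ lists distinct variables with value types and the ''stoup'' holds at most one variable, of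 computation type; with nonempty stoup the result type is a computation type. Below $\Delta$ is empty or $z{:}\underline{D}$. Typing rules: $\Gamma,x{:}A\mid-\vdash x:A$; $\Gamma\mid-\vdash *:1$; pairs $\langle t,u\rangle:A\times B$, projections $\pi_1t,\pi_2t$; $\lambda x{:}A.t:A\to B$ from $\Gamma,x{:}A\mid-\vdash t:B$; application $t\,u$ (all with empty stoup). $\Gamma\mid z{:}\underline A\vdash z:\underline A$; $\Gamma\mid\Delta\vdash\underline{*}:\underline 1$; from $\Gamma\mid\Delta\vdash t:\underline A$, $\Gamma\mid\Delta\vdash u:\underline B$ get $\Gamma\mid\Delta\vdash\langle t,u\rangle_c:\underline A\,\&\,\underline B$, and from $\Gamma\mid\Delta\vdash t:\underline A\,\&\,\underline B$ get $\underline\pi_1t:\underline A$, $\underline\pi_2t:\underline B$; from $\Gamma,x{:}A\mid\Delta\vdash t:\underline B$ get $\Gamma\mid\Delta\vdash\underline\lambda x{:}A.t:A\Rightarrow\underline B$; from $\Gamma\mid\Delta\vdash s:A\Rightarrow\underline B$, $\Gamma\mid-\vdash t:A$ get $\Gamma\mid\Delta\vdash s@t:\underline B$; $\Gamma\mid-\vdash\top:\underline I$; from $\Gamma\mid\Delta\vdash t:\underline I$, $\Gamma\mid-\vdash u:\underline A$ get $\Gamma\mid\Delta\vdash \mathrm{let}\ \top\ \mathrm{be}\ t\ \mathrm{in}\ u:\underline A$; from $\Gamma\mid-\vdash t:A$ get $\Gamma\mid-\vdash\,!t:\,!A$; from $\Gamma\mid\Delta\vdash t:\,!A$, $\Gamma,x{:}A\mid-\vdash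 u:\underline B$ get $\Gamma\mid\Delta\vdash\mathrm{let}\ !x\ \mathrm{be}\ t\ \mathrm{in}\ u:\underline B$; from $\Gamma\mid-\vdash t:A$, $\Gamma\mid\Delta\vdash u:\underline B$ get $\Gamma\mid\Delta\vdash\,!t\otimes u:\,!A\otimes\underline B$; from $\Gamma\mid\Delta\vdash s:\,!A\otimes\underline B$, $\Gamma,x{:}A\mid y{:}\underline B\vdash t:\underline C$ get $\Gamma\mid\Delta\vdash\mathrm{let}\ !x\otimes y\ \mathrm{be}\ s\ \mathrm{in}\ t:\underline C$; from $\Gamma\mid\Delta\vdash t:\underline 0$ get $\Gamma\mid\Delta\vdash\mathrm{abort}_{\underline A}(t):\underline A$; $\mathrm{inl}\,t:\underline A\oplus\underline B$ from $t:\underline A$ and $\mathrm{inr}\,t$ from $t:\underline B$ (same $\Gamma\mid\Delta$); from $\Gamma\mid\Delta\vdash s:\underline A\oplus\underline B$, $\Gamma\mid x{:}\underline A\vdash t:\underline C$, $\Gamma\mid y{:}\underline B\vdash u:\underline C$ get $\Gamma\mid\Delta\vdash\mathrm{case}\ s\ \mathrm{of}\ (\mathrm{inl}\,x\Rightarrow t\mid\mathrm{inr}\,y\Rightarrow u):\underline C$; from $\Gamma\mid z{:}\underline A\vdash t:\underline B$ get $\Gamma\mid-\vdash\hat\lambda z{:}\underline A.t:\underline A\multimap\underline B$; from $\Gamma\mid-\vdash s:\underline A\multimap\underline B$, $\Gamma\mid\Delta\vdash t:\underline A$ get $\Gamma\mid\Delta\vdash s\{t\}:\underline B$. Equality $\Gamma\mid\Delta\vdash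 t=u:A$ is the least typed congruence (equivalence, compatible with all term formers, containing $\alpha$-equivalence) containing all well-typed instances of: $t=*$ for $t:1$; $\pi_1\langle t,u\rangle=t$, $\pi_2\langle t,u\rangle=u$, $\langle\pi_1t,\pi_2t\rangle=t$; $(\lambda x.t)u=t[u/x]$, $\lambda x.(t\,x)=t$ ($x$ not free in $t$); $t=\underline*$ for $t:\underline1$; $\underline\pi_1\langle t,u\rangle_c=t$, $\underline\pi_2\langle t,u\rangle_c=u$, $\langle\underline\pi_1t,\underline\pi_2t\rangle_c=t$; $(\underline\lambda x.t)@u=t[u/x]$, $\underline\lambda x.(t@x)=t$ ($x$ not free); $\mathrm{let}\ \top\ \mathrm{be}\ \top\ \mathrm{in}\ t=t$; $\mathrm{let}\ \top\ \mathrm{be}\ t\ \mathrm{in}\ u[\top/x]=u[t/x]$ for $\Gamma\mid x{:}\underline I\vdash u:\underline A$; $\mathrm{let}\ !x\ \mathrm{be}\ !t\ \mathrm{in}\ u=u[t/x]$; $\mathrm{let}\ !x\ \mathrm{be}\ t\ \mathrm{in}\ u[!x/y]=u[t/y]$ for $\Gamma\mid y{:}\,!A\vdash u:\underline B$; $\mathrm{let}\ !x\otimes y\ \mathrm{be}\ !t\otimes s\ \mathrm{in}\ u=u[t/x,s/y]$; $\mathrm{let}\ !x\otimes y\ \mathrm{be}\ t\ \mathrm{in}\ u[(!x\otimes y)/z]=u[t/z]$ for $\Gamma\mid z{:}\,!A\otimes\underline B\vdash u:\underline C$; $\mathrm{abort}_{\underline A}(t)=u[t/x]$ for $\Gamma\mid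 x{:}\underline 0\vdash u:\underline A$; $\mathrm{case}\ \mathrm{inl}\,t\ \mathrm{of}\ (\mathrm{inl}\,x\Rightarrow u\mid\mathrm{inr}\,y\Rightarrow u')=u[t/x]$ and symmetrically for $\mathrm{inr}$; $\mathrm{case}\ t\ \mathrm{of}\ (\mathrm{inl}\,x\Rightarrow u[\mathrm{inl}\,x/z]\mid\mathrm{inr}\,y\Rightarrow u[\mathrm{inr}\,y/z])=u[t/z]$ for $\Gamma\mid z{:}\underline A\oplus\underline B\vdash u:\underline C$; $(\hat\lambda x.t)\{u\}=t[u/x]$, $\hat\lambda x.(t\{x\})=t$ ($x$ not free). **Simply-typed $\lambda$-calculus.** Types $\sigma,\tau::=\alpha\mid 1\mid\sigma\times\tau\mid\sigma\to\tau$; terms $x,*,\langle M,N\rangle,\pi_1M,\pi_2M,\lambda x{:}\sigma.M,M\,N$ with the standard typing in contexts $\Theta=x_1{:}\sigma_1,\ldots,x_n{:}\sigma_n$. $=_{\beta\eta}$ is the standard $\beta\eta$-equality (including $M=*$ for $M:1$ and surjective pairing). Each $\lambda$-calculus type constant $\alpha$ has an associated EEC computation-type constant $\underline\alpha$. **Linear-use cbn CPS translation** (relative to $\underline R$): $\alpha^{ln}=\underline\alpha$, $1^{ln}=\underline 0$, $(\sigma\times\tau)^{ln}=\sigma^{ln}\oplus\tau^{ln}$, $(\sigma\to\tau)^{ln}=\,!(\sigma^{ln}\multimap\underline R)\otimes\tau^{ln}$; $\Theta^{ln}\multimap\underline R$ denotes $x_1{:}\sigma_1^{ln}\multimap\underline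 R,\ldots,x_n{:}\sigma_n^{ln}\multimap\underline R$. A judgement $\Theta\vdash M:\tau$ is sent to $\Theta^{ln}\multimap\underline R\mid-\vdash M^{ln}:\tau^{ln}\multimap\underline R$ where: $x^{ln}=x$; $*^{ln}=\hat\lambda k{:}\underline 0.\,\mathrm{abort}_{\underline R}(k)$; $\langle M,N\rangle^{ln}=\hat\lambda k{:}\sigma^{ln}\oplus\tau^{ln}.\,\mathrm{case}\ k\ \mathrm{of}\ (\mathrm{inl}\,x\Rightarrow M^{ln}\{x\}\mid\mathrm{inr}\,y\Rightarrow N^{ln}\{y\})$; $(\pi_1M)^{ln}=\hat\lambda k{:}\sigma^{ln}.\,M^{ln}\{\mathrm{inl}\,k\}$; $(\pi_2M)^{ln}=\hat\lambda k{:}\tau^{ln}.\,M^{ln}\{\mathrm{inr}\,k\}$; $(\lambda x{:}\sigma.M)^{ln}=\hat\lambda k{:}\,!(\sigma^{ln}\multimap\underline R)\otimes\tau^{ln}.\,\mathrm{let}\ !x\otimes h\ \mathrm{be}\ k\ \mathrm{in}\ M^{ln}\{h\}$; for $M:\sigma\to\tau$, $N:\sigma$: $(M\,N)^{ln}=\hat\lambda k{:}\tau^{ln}.\,M^{ln}\{!(N^{ln})\otimes k\}$. *)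

(* Defs.v *)
From Stdlib Require Import List.
Import ListNotations.

Set Implicit Arguments.
Unset Strict Implicit.
Unset Printing Implicit Defensive.

(* Both calculi are given as intrinsically typed de Bruijn syntax: an element
   of [tm Theta tau] is a typing derivation of a term up to alpha-equivalence.
   Contexts are lists with the most recently bound variable at the head. *)

Inductive var (T : Type) : list T -> T -> Type :=
| vz : forall G A, var (A :: G) A
| vs : forall G A B, var G A -> var (B :: G) A.
Arguments vz {T G A}.
Arguments vs {T G A B} _.

Definition renaming (T : Type) (G G' : list T) := forall A, var G A -> var G' A.

Definition lift_ren T (G G' : list T) B (r : renaming G G') :
  renaming (B :: G) (B :: G') :=
  fun A x =>
    match x in var G0 A0
      return match G0 with
             | [] => unit
             | B0 :: G1 => (forall C, var G1 C -> var G' C) -> var (B0 :: G') A0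
             end with
    | vz => fun _ => vz
    | vs y => fun r => vs (r _ y)
    end r.

Fixpoint map_var T U (f : T -> U) (G : list T) (A : T) (x : var G A) :
  var (map f G) (f A) :=
  match x with
  | vz => vz
  | vs y => vs (map_var f y)
  end.

(** * Simply-typed lambda-calculus *)

Section Lambda.
Context {LK : Type}.

Inductive ty : Type :=
| TConst (a : LK)
| TUnit
| TProd (s t : ty)
| TArr (s t : ty).

Inductive tm : list ty -> ty -> Type :=
| LVar : forall T s, var T s -> tm T s
| LStar : forall T, tm T TUnit
| LPair : forall T s t, tm T s -> tm T t -> tm T (TProd s t)
| LFst : forall T s t, tm T (TProd s t) -> tm T s
| LSnd : forall T s t, tm T (TProd s t) -> tm T t
| LLam : forall T s t, tm (s :: T) t -> tm T (TArr s t)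
| LApp : forall T s t, tm T (TArr s t) -> tm T s -> tm T t.

Fixpoint lren T s (M : tm T s) : forall T', renaming T T' -> tm T' s :=
  match M with
  | LVar x => fun _ r => LVar (r _ x)
  | LStar _ => fun T' _ => LStar T'
  | LPair M N => fun _ r => LPair (lren M r) (lren N r)
  | LFst M => fun _ r => LFst (lren M r)
  | LSnd M => fun _ r => LSnd (lren M r)
  | LLam M => fun _ r => LLam (lren M (lift_ren r))
  | LApp M N => fun _ r => LApp (lren M r) (lren N r)
  end.

Definition lwk T s u (M : tm T s) : tm (u :: T) s := lren M (fun _ x => vs x).

Definition lsubst (T T' : list ty) := forall s, var T s -> tm T' s.

Definition lcons T T' u (N : tm T' u) (f : lsubst T T') : lsubst (u :: T) T' :=
  fun s x =>
    match x in var T0 s0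
      return match T0 with
             | [] => unit
             | u0 :: T1 => tm T' u0 -> (forall v, var T1 v -> tm T' v) -> tm T' s0
             end with
    | vz => fun N _ => N
    | vs y => fun _ f => f _ y
    end N f.

Definition llift T T' u (f : lsubst T T') : lsubst (u :: T) (u :: T') :=
  lcons (LVar vz) (fun s x => lwk u (f s x)).

Fixpoint lsub T s (M : tm T s) : forall T', lsubst T T' -> tm T' s :=
  match M with
  | LVar x => fun _ f => f _ x
  | LStar _ => fun T' _ => LStar T'
  | LPair M N => fun _ f => LPair (lsub M f) (lsub N f)
  | LFst M => fun _ f => LFst (lsub M f)
  | LSnd M => fun _ f => LSnd (lsub M f)
  | LLam M => fun _ f => LLam (lsub M (llift f))
  | LApp M N => fun _ f => LApp (lsub M f) (lsub N f)
  end.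

Definition lsub1 T s u (M : tm (u :: T) s) (N : tm T u) : tm T s :=
  lsub M (lcons N (fun _ x => LVar x)).

Inductive leq : forall T s, tm T s -> tm T s -> Prop :=
| leq_refl : forall T s (M : tm T s), leq M M
| leq_sym : forall T s (M N : tm T s), leq M N -> leq N M
| leq_trans : forall T s (M N P : tm T s), leq M N -> leq N P -> leq M P
| leq_pair : forall T s t (M M' : tm T s) (N N' : tm T t),
    leq M M' -> leq N N' -> leq (LPair M N) (LPair M' N')
| leq_fst : forall T s t (M M' : tm T (TProd s t)),
    leq M M' -> leq (LFst M) (LFst M')
| leq_snd : forall T s t (M M' : tm T (TProd s t)),
    leq M M' -> leq (LSnd M) (LSnd M')
| leq_lam : forall T s t (M M' : tm (s :: T) t),
    leq M M' -> leq (LLam M) (LLam M')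
| leq_app : forall T s t (M M' : tm T (TArr s t)) (N N' : tm T s),
    leq M M' -> leq N N' -> leq (LApp M N) (LApp M' N')
| leq_unit_eta : forall T (M : tm T TUnit), leq M (LStar T)
| leq_fst_beta : forall T s t (M : tm T s) (N : tm T t),
    leq (LFst (LPair M N)) M
| leq_snd_beta : forall T s t (M : tm T s) (N : tm T t),
    leq (LSnd (LPair M N)) N
| leq_pair_eta : forall T s t (M : tm T (TProd s t)),
    leq (LPair (LFst M) (LSnd M)) M
| leq_lam_beta : forall T s t (M : tm (s :: T) t) (N : tm T s),
    leq (LApp (LLam M) N) (lsub1 M N)
| leq_lam_eta : forall T s t (M : tm T (TArr s t)),
    leq (LLam (LApp (lwk s M) (LVar vz))) M.

End Lambda.
Arguments ty LK : clear implicits.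

(** * The enriched effect calculus *)

Section EEC.
Context {VK CK : Type}.

Inductive vty : Type :=
| VConst (a : VK)
| VUnit
| VProd (A B : vty)
| VArr (A B : vty)
| VComp (A : cty)
| VLolli (A B : cty)
with cty : Type :=
| CConst (a : CK)
| CUnit
| CWith (A B : cty)
| CArr (A : vty) (B : cty)
| CI
| CBang (A : vty)
| CTens (A : vty) (B : cty)   (* the primitive type !A (x) B *)
| CZero
| CPlus (A B : cty).

Coercion VComp : cty >-> vty.

(* [etm G D A] is the judgement G | D |- t : A.  The stoup D is [None] or
   [Some C]; its variable, if any, is nameless and denoted by [EStoup].  The
   injections carry the other summand as an implicit type argument. *)
Inductive etm : list vty -> option cty -> vty -> Type :=
| EVar : forall G A, var G A -> etm G None A
| EStar : forall G, etm G None VUnit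
| EPair : forall G A B, etm G None A -> etm G None B -> etm G None (VProd A B)
| EFst : forall G A B, etm G None (VProd A B) -> etm G None A
| ESnd : forall G A B, etm G None (VProd A B) -> etm G None B
| ELam : forall G A B, etm (A :: G) None B -> etm G None (VArr A B)
| EApp : forall G A B, etm G None (VArr A B) -> etm G None A -> etm G None B
| EStoup : forall G (A : cty), etm G (Some A) A
| ECStar : forall G D, etm G D CUnit
| ECPair : forall G D (A B : cty), etm G D A -> etm G D B -> etm G D (CWith A B)
| ECFst : forall G D A B, etm G D (CWith A B) -> etm G D A
| ECSnd : forall G D A B, etm G D (CWith A B) -> etm G D B
| ECLam : forall G D A (B : cty), etm (A :: G) D B -> etm G D (CArr A B)
| ECApp : forall G D A B, etm G D (CArr A B) -> etm G None A -> etm G D B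
| ETop : forall G, etm G None CI
| ELetTop : forall G D (A : cty), etm G D CI -> etm G None A -> etm G D A
| EBang : forall G A, etm G None A -> etm G None (CBang A)
| ELetBang : forall G D A (B : cty),
    etm G D (CBang A) -> etm (A :: G) None B -> etm G D B
| ETens : forall G D A (B : cty),
    etm G None A -> etm G D B -> etm G D (CTens A B)
| ELetTens : forall G D A (B C : cty),
    etm G D (CTens A B) -> etm (A :: G) (Some B) C -> etm G D C
| EAbort : forall G D (A : cty), etm G D CZero -> etm G D A
| EInl : forall G D (A B : cty), etm G D A -> etm G D (CPlus A B)
| EInr : forall G D (A B : cty), etm G D B -> etm G D (CPlus A B)
| ECase : forall G D (A B C : cty),
    etm G D (CPlus A B) -> etm G (Some A) C -> etm G (Some B) C -> etm G D C
| ELLam : forall G (A B : cty), etm G (Some A) B -> etm G None (VLolli A B)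
| ELApp : forall G D A B, etm G None (VLolli A B) -> etm G D A -> etm G D B.

Fixpoint eren G D A (t : etm G D A) : forall G', renaming G G' -> etm G' D A :=
  match t with
  | EVar x => fun _ r => EVar (r _ x)
  | EStar _ => fun G' _ => EStar G'
  | EPair t u => fun _ r => EPair (eren t r) (eren u r)
  | EFst t => fun _ r => EFst (eren t r)
  | ESnd t => fun _ r => ESnd (eren t r)
  | ELam t => fun _ r => ELam (eren t (lift_ren r))
  | EApp t u => fun _ r => EApp (eren t r) (eren u r)
  | EStoup _ A => fun G' _ => EStoup G' A
  | ECStar _ D => fun G' _ => ECStar G' D
  | ECPair t u => fun _ r => ECPair (eren t r) (eren u r)
  | ECFst t => fun _ r => ECFst (eren t r)
  | ECSnd t => fun _ r => ECSnd (eren t r)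
  | ECLam t => fun _ r => ECLam (eren t (lift_ren r))
  | ECApp t u => fun _ r => ECApp (eren t r) (eren u r)
  | ETop _ => fun G' _ => ETop G'
  | ELetTop t u => fun _ r => ELetTop (eren t r) (eren u r)
  | EBang t => fun _ r => EBang (eren t r)
  | ELetBang t u => fun _ r => ELetBang (eren t r) (eren u (lift_ren r))
  | ETens t u => fun _ r => ETens (eren t r) (eren u r)
  | ELetTens t u => fun _ r => ELetTens (eren t r) (eren u (lift_ren r))
  | EAbort A t => fun _ r => EAbort A (eren t r)
  | EInl B t => fun _ r => EInl B (eren t r)
  | EInr A t => fun _ r => EInr A (eren t r)
  | ECase s t u => fun _ r => ECase (eren s r) (eren t r) (eren u r)
  | ELLam t => fun _ r => ELLam (eren t r)
  | ELApp s t => fun _ r => ELApp (eren s r) (eren t r)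
  end.

Definition ewk G D A B (t : etm G D A) : etm (B :: G) D A :=
  eren t (fun _ x => vs x).

Definition esubst (G G' : list vty) := forall A, var G A -> etm G' None A.

Definition eids G : esubst G G := fun _ x => EVar x.

Definition econs G G' B (u : etm G' None B) (f : esubst G G') :
  esubst (B :: G) G' :=
  fun A x =>
    match x in var G0 A0
      return match G0 with
             | [] => unit
             | B0 :: G1 =>
                 etm G' None B0 -> (forall C, var G1 C -> etm G' None C) ->
                 etm G' None A0
             end with
    | vz => fun u _ => u
    | vs y => fun _ f => f _ y
    end u f.

Definition elift G G' B (f : esubst G G') : esubst (B :: G) (B :: G') :=
  econs (EVar vz) (fun A x => ewk B (f A x)).

(* [stsubst G' D D'] is what replaces the stoup D when a term is moved to
   G' | D': nothing if D is empty (then D' is empty as well), and a term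
   G' | D' |- u : C if D = [Some C]. *)
Inductive stsubst (G' : list vty) : option cty -> option cty -> Type :=
| SNone : stsubst G' None None
| SSome : forall (C : cty) D', etm G' D' C -> stsubst G' (Some C) D'.
Arguments SNone {G'}.

Definition stid G D : stsubst G D D :=
  match D with
  | None => SNone
  | Some C => SSome (EStoup G C)
  end.

Definition stwk G D D' B (d : stsubst G D D') : stsubst (B :: G) D D' :=
  match d with
  | SNone => SNone
  | SSome u => SSome (ewk B u)
  end.

Definition stcast G D' A (d : stsubst G None D') (t : etm G None A) :
  etm G D' A :=
  match d in stsubst _ D0 D1
    return match D0 with None => etm G D1 A | Some _ => unit end with
  | SNone => t
  | SSome _ => tt
  end.

Definition stget G C D' (d : stsubst G (Some C) D') : etm G D' C :=
  match d in stsubst _ D0 D1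
    return match D0 with None => unit | Some C0 => etm G D1 C0 end with
  | SNone => tt
  | SSome u => u
  end.

Fixpoint esub G D A (t : etm G D A) :
  forall G' D', esubst G G' -> stsubst G' D D' -> etm G' D' A :=
  match t with
  | EVar x => fun _ _ f d => stcast d (f _ x)
  | EStar _ => fun _ _ f d => stcast d (EStar _)
  | EPair t u => fun _ _ f d =>
      stcast d (EPair (esub t f SNone) (esub u f SNone))
  | EFst t => fun _ _ f d => stcast d (EFst (esub t f SNone))
  | ESnd t => fun _ _ f d => stcast d (ESnd (esub t f SNone))
  | ELam t => fun _ _ f d => stcast d (ELam (esub t (elift f) SNone))
  | EApp t u => fun _ _ f d =>
      stcast d (EApp (esub t f SNone) (esub u f SNone))
  | EStoup _ _ => fun _ _ _ d => stget d
  | ECStar _ _ => fun _ _ _ _ => ECStar _ _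
  | ECPair t u => fun _ _ f d => ECPair (esub t f d) (esub u f d)
  | ECFst t => fun _ _ f d => ECFst (esub t f d)
  | ECSnd t => fun _ _ f d => ECSnd (esub t f d)
  | ECLam t => fun _ _ f d => ECLam (esub t (elift f) (stwk _ d))
  | ECApp s t => fun _ _ f d => ECApp (esub s f d) (esub t f SNone)
  | ETop _ => fun _ _ f d => stcast d (ETop _)
  | ELetTop t u => fun _ _ f d => ELetTop (esub t f d) (esub u f SNone)
  | EBang t => fun _ _ f d => stcast d (EBang (esub t f SNone))
  | ELetBang t u => fun _ _ f d =>
      ELetBang (esub t f d) (esub u (elift f) SNone)
  | ETens t u => fun _ _ f d => ETens (esub t f SNone) (esub u f d)
  | ELetTens s t => fun _ _ f d =>
      ELetTens (esub s f d) (esub t (elift f) (stid _ _))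
  | EAbort A t => fun _ _ f d => EAbort A (esub t f d)
  | EInl B t => fun _ _ f d => EInl B (esub t f d)
  | EInr A t => fun _ _ f d => EInr A (esub t f d)
  | ECase s t u => fun _ _ f d =>
      ECase (esub s f d) (esub t f (stid _ _)) (esub u f (stid _ _))
  | ELLam t => fun _ _ f d => stcast d (ELLam (esub t f (stid _ _)))
  | ELApp s t => fun _ _ f d => ELApp (esub s f SNone) (esub t f d)
  end.

(* t[u/x] for x in the context, and for x in the stoup. *)
Definition esub1 G D A B (t : etm (B :: G) D A) (u : etm G None B) : etm G D A :=
  esub t (econs u (eids (G := G))) (stid G D).

Definition stsub1 G D A (B : cty) (t : etm G (Some B) A) (u : etm G D B) :
  etm G D A :=
  esub t (eids (G := G)) (SSome u).

Inductive eeq : forall G D A, etm G D A -> etm G D A -> Prop :=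
| eeq_refl : forall G D A (t : etm G D A), eeq t t
| eeq_sym : forall G D A (t u : etm G D A), eeq t u -> eeq u t
| eeq_trans : forall G D A (t u v : etm G D A), eeq t u -> eeq u v -> eeq t v
(* compatibility with the term formers *)
| eeq_pair : forall G A B (t t' : etm G None A) (u u' : etm G None B),
    eeq t t' -> eeq u u' -> eeq (EPair t u) (EPair t' u')
| eeq_fst : forall G A B (t t' : etm G None (VProd A B)),
    eeq t t' -> eeq (EFst t) (EFst t')
| eeq_snd : forall G A B (t t' : etm G None (VProd A B)),
    eeq t t' -> eeq (ESnd t) (ESnd t')
| eeq_lam : forall G A B (t t' : etm (A :: G) None B),
    eeq t t' -> eeq (ELam t) (ELam t')
| eeq_app : forall G A B (t t' : etm G None (VArr A B)) (u u' : etm G None A),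
    eeq t t' -> eeq u u' -> eeq (EApp t u) (EApp t' u')
| eeq_cpair : forall G D (A B : cty) (t t' : etm G D A) (u u' : etm G D B),
    eeq t t' -> eeq u u' -> eeq (ECPair t u) (ECPair t' u')
| eeq_cfst : forall G D A B (t t' : etm G D (CWith A B)),
    eeq t t' -> eeq (ECFst t) (ECFst t')
| eeq_csnd : forall G D A B (t t' : etm G D (CWith A B)),
    eeq t t' -> eeq (ECSnd t) (ECSnd t')
| eeq_clam : forall G D A (B : cty) (t t' : etm (A :: G) D B),
    eeq t t' -> eeq (ECLam t) (ECLam t')
| eeq_capp : forall G D A B (s s' : etm G D (CArr A B)) (t t' : etm G None A),
    eeq s s' -> eeq t t' -> eeq (ECApp s t) (ECApp s' t')
| eeq_lettop : forall G D (A : cty) (t t' : etm G D CI) (u u' : etm G None A),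
    eeq t t' -> eeq u u' -> eeq (ELetTop t u) (ELetTop t' u')
| eeq_bang : forall G A (t t' : etm G None A),
    eeq t t' -> eeq (EBang t) (EBang t')
| eeq_letbang : forall G D A (B : cty) (t t' : etm G D (CBang A))
    (u u' : etm (A :: G) None B),
    eeq t t' -> eeq u u' -> eeq (ELetBang t u) (ELetBang t' u')
| eeq_tens : forall G D A (B : cty) (t t' : etm G None A) (u u' : etm G D B),
    eeq t t' -> eeq u u' -> eeq (ETens t u) (ETens t' u')
| eeq_lettens : forall G D A (B C : cty) (s s' : etm G D (CTens A B))
    (t t' : etm (A :: G) (Some B) C),
    eeq s s' -> eeq t t' -> eeq (ELetTens s t) (ELetTens s' t')
| eeq_abort : forall G D (A : cty) (t t' : etm G D CZero),
    eeq t t' -> eeq (EAbort A t) (EAbort A t')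
| eeq_inl : forall G D (A B : cty) (t t' : etm G D A),
    eeq t t' -> eeq (EInl B t) (EInl B t')
| eeq_inr : forall G D (A B : cty) (t t' : etm G D B),
    eeq t t' -> eeq (EInr A t) (EInr A t')
| eeq_case : forall G D (A B C : cty) (s s' : etm G D (CPlus A B))
    (t t' : etm G (Some A) C) (u u' : etm G (Some B) C),
    eeq s s' -> eeq t t' -> eeq u u' -> eeq (ECase s t u) (ECase s' t' u')
| eeq_llam : forall G (A B : cty) (t t' : etm G (Some A) B),
    eeq t t' -> eeq (ELLam t) (ELLam t')
| eeq_lapp : forall G D A B (s s' : etm G None (VLolli A B)) (t t' : etm G D A),
    eeq s s' -> eeq t t' -> eeq (ELApp s t) (ELApp s' t')
(* beta and eta axioms *)
| eeq_unit_eta : forall G (t : etm G None VUnit), eeq t (EStar G)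
| eeq_fst_beta : forall G A B (t : etm G None A) (u : etm G None B),
    eeq (EFst (EPair t u)) t
| eeq_snd_beta : forall G A B (t : etm G None A) (u : etm G None B),
    eeq (ESnd (EPair t u)) u
| eeq_pair_eta : forall G A B (t : etm G None (VProd A B)),
    eeq (EPair (EFst t) (ESnd t)) t
| eeq_lam_beta : forall G A B (t : etm (A :: G) None B) (u : etm G None A),
    eeq (EApp (ELam t) u) (esub1 t u)
| eeq_lam_eta : forall G A B (t : etm G None (VArr A B)),
    eeq (ELam (EApp (ewk A t) (EVar vz))) t
| eeq_cunit_eta : forall G D (t : etm G D CUnit), eeq t (ECStar G D)
| eeq_cfst_beta : forall G D (A B : cty) (t : etm G D A) (u : etm G D B),
    eeq (ECFst (ECPair t u)) t
| eeq_csnd_beta : forall G D (A B : cty) (t : etm G D A) (u : etm G D B),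
    eeq (ECSnd (ECPair t u)) u
| eeq_cpair_eta : forall G D A B (t : etm G D (CWith A B)),
    eeq (ECPair (ECFst t) (ECSnd t)) t
| eeq_clam_beta : forall G D A (B : cty) (t : etm (A :: G) D B) (u : etm G None A),
    eeq (ECApp (ECLam t) u) (esub1 t u)
| eeq_clam_eta : forall G D A B (t : etm G D (CArr A B)),
    eeq (ECLam (ECApp (ewk A t) (EVar vz))) t
| eeq_lettop_beta : forall G (A : cty) (t : etm G None A),
    eeq (ELetTop (ETop G) t) t
| eeq_lettop_eta : forall G D (A : cty) (t : etm G D CI) (u : etm G (Some CI) A),
    eeq (ELetTop t (stsub1 u (ETop G))) (stsub1 u t)
| eeq_letbang_beta : forall G A (B : cty) (t : etm G None A)
    (u : etm (A :: G) None B),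
    eeq (ELetBang (EBang t) u) (esub1 u t)
| eeq_letbang_eta : forall G D A (B : cty) (t : etm G D (CBang A))
    (u : etm G (Some (CBang A)) B),
    eeq (ELetBang t (stsub1 (ewk A u) (EBang (EVar vz)))) (stsub1 u t)
| eeq_lettens_beta : forall G D A (B C : cty) (t : etm G None A) (s : etm G D B)
    (u : etm (A :: G) (Some B) C),
    eeq (ELetTens (ETens t s) u) (esub u (econs t (eids (G := G))) (SSome s))
| eeq_lettens_eta : forall G D A (B C : cty) (t : etm G D (CTens A B))
    (u : etm G (Some (CTens A B)) C),
    eeq (ELetTens t (stsub1 (ewk A u) (ETens (EVar vz) (EStoup (A :: G) B))))
        (stsub1 u t)
| eeq_abort_eta : forall G D (A : cty) (t : etm G D CZero)
    (u : etm G (Some CZero) A),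
    eeq (EAbort A t) (stsub1 u t)
| eeq_inl_beta : forall G D (A B C : cty) (t : etm G D A)
    (u : etm G (Some A) C) (u' : etm G (Some B) C),
    eeq (ECase (EInl B t) u u') (stsub1 u t)
| eeq_inr_beta : forall G D (A B C : cty) (t : etm G D B)
    (u : etm G (Some A) C) (u' : etm G (Some B) C),
    eeq (ECase (EInr A t) u u') (stsub1 u' t)
| eeq_case_eta : forall G D (A B C : cty) (t : etm G D (CPlus A B))
    (u : etm G (Some (CPlus A B)) C),
    eeq (ECase t (stsub1 u (EInl B (EStoup G A))) (stsub1 u (EInr A (EStoup G B))))
        (stsub1 u t)
| eeq_llam_beta : forall G D (A B : cty) (t : etm G (Some A) B) (u : etm G D A),
    eeq (ELApp (ELLam t) u) (stsub1 t u)
| eeq_llam_eta : forall G A B (t : etm G None (VLolli A B)),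
    eeq (ELLam (ELApp t (EStoup G A))) t.

End EEC.
Arguments vty VK CK : clear implicits.
Arguments cty VK CK : clear implicits.

(** * Linear-use call-by-name CPS translation *)

Section CPS.
Context {VK CK LK : Type} (und : LK -> CK) (R : cty VK CK).

Fixpoint ln_ty (s : ty LK) : cty VK CK :=
  match s with
  | TConst a => CConst (und a)
  | TUnit => CZero
  | TProd s t => CPlus (ln_ty s) (ln_ty t)
  | TArr s t => CTens (VLolli (ln_ty s) R) (ln_ty t)
  end.

Definition ln_neg (s : ty LK) : vty VK CK := VLolli (ln_ty s) R.

Definition ln_ctx (T : list (ty LK)) : list (vty VK CK) := map ln_neg T.

Fixpoint ln_tm T s (M : tm T s) : etm (ln_ctx T) None (ln_neg s) :=
  match M in tm T s return etm (ln_ctx T) None (ln_neg s) with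
  | LVar x => EVar (map_var ln_neg x)
  | LStar _ => ELLam (EAbort R (EStoup _ CZero))
  | @LPair _ _ s t M N =>
      ELLam (ECase (EStoup _ (CPlus (ln_ty s) (ln_ty t)))
               (ELApp (ln_tm M) (EStoup _ (ln_ty s)))
               (ELApp (ln_tm N) (EStoup _ (ln_ty t))))
  | @LFst _ _ s t M =>
      ELLam (ELApp (ln_tm M) (EInl (ln_ty t) (EStoup _ (ln_ty s))))
  | @LSnd _ _ s t M =>
      ELLam (ELApp (ln_tm M) (EInr (ln_ty s) (EStoup _ (ln_ty t))))
  | @LLam _ _ s t M =>
      ELLam (ELetTens (EStoup _ (CTens (ln_neg s) (ln_ty t)))
               (ELApp (ln_tm M) (EStoup _ (ln_ty t))))
  | @LApp _ _ s t M N =>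
      ELLam (ELApp (ln_tm M) (ETens (ln_tm N) (EStoup _ (ln_ty t))))
  end.

End CPS.

(* Main.v *)
(* Faithfulness: EEC has a model in sets in which computation types are
   interpreted in the opposite category and R is pointed, so that M^ln denotes
   the set-theoretic meaning of M.  When type constants denote families of sets
   of lambda-terms, normalisation by evaluation recovers M up to beta-eta from
   this meaning.

   Fullness: consider a Kripke logical predicate, indexed by lambda-contexts, that
   at a computation type C classifies the linear maps from C to R.  It is generated
   by the definable maps at the constants and contains only the identity at R; for
   R = I this holds when top is the only admissible term of type R.  Induction on
   tau then shows that at tau^ln it consists exactly of the maps k |-> M^ln{k}. *)

From Stdlib Require Import List FunctionalExtensionality Program.Equality Eqdep.
Require Import Defs.
Import ListNotations.

Set Implicit Arguments.
Unset Strict Implicit.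
Unset Printing Implicit Defensive.

(** * Variables, renamings and context extensions *)

(** The motive is chosen by matching on the context, so the index [B :: G] survives the case
    analysis and no axiom is involved. *)
Definition var_case T (G : list T) (B : T) (P : forall A, var (B :: G) A -> Prop)
  (hz : P B vz) (hs : forall A (y : var G A), P A (vs y)) A (x : var (B :: G) A) :
  P A x :=
  match x as x0 in var G0 A0
    return match G0 as G1 return var G1 A0 -> Prop with
           | [] => fun _ => True
           | B0 :: G1 => fun x1 =>
               forall P : forall A, var (B0 :: G1) A -> Prop,
               P B0 vz -> (forall A (y : var G1 A), P A (vs y)) -> P A0 x1
           end x0 with
  | vz => fun P hz _ => hz
  | vs y => fun P _ hs => hs _ y
  end P hz hs.

(** [map f G] is not a constructor form, so variables of a translated context cannot be matched on
    directly; each is first exhibited as the image of a variable of [G]. *)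
Lemma map_var_case T U (f : T -> U) (G : list T) (P : forall B, var (map f G) B -> Prop) :
  (forall A (x : var G A), P _ (map_var f x)) -> forall B x, P B x.
Proof.
  induction G as [|A G IH]; intros h; simpl.
  - intros B x. inversion x.
  - apply var_case; [exact (h _ vz)|].
    apply (IH (fun B y => P B (vs y))). intros A' x. exact (h _ (vs x)).
Qed.

Ltac funvar :=
  let A := fresh "A" in let x := fresh "x" in
  apply functional_extensionality_dep; intro A;
  apply functional_extensionality_dep; intro x;
  revert A x; try apply var_case; intros.

Lemma lift_ren_id T (G : list T) B :
  lift_ren (B := B) (fun A (x : var G A) => x) = fun A x => x.
Proof. funvar; reflexivity. Qed.

Lemma lift_ren_comp T (G G' G'' : list T) B (r : renaming G G') (r' : renaming G' G'') :
  (fun A x => lift_ren (B := B) r' (lift_ren r x)) = lift_ren (fun A x => r' A (r A x)).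
Proof. funvar; reflexivity. Qed.

(** Extensions at the head order the worlds of the Kripke arguments below. Unlike arbitrary
    renamings they are determined by their endpoints ([ext_unique]), so a fresh variable can be
    located from the context alone. *)
Inductive ext T (G : list T) : list T -> Type :=
| ext_refl : ext G G
| ext_cons : forall A G', ext G G' -> ext G (A :: G').
Arguments ext_refl {T G}.
Arguments ext_cons {T G} A {G'} _.

Fixpoint ext_ren T (G G' : list T) (e : ext G G') : renaming G G' :=
  match e with
  | ext_refl => fun _ x => x
  | ext_cons _ e => fun _ x => vs (ext_ren e x)
  end.

Fixpoint ext_trans T (G G' G'' : list T) (e : ext G G') (e' : ext G' G'') : ext G G'' :=
  match e' with
  | ext_refl => e
  | ext_cons A e' => ext_cons A (ext_trans e e')
  end.

Fixpoint ext_map T U (f : T -> U) (G G' : list T) (e : ext G G') :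
  ext (map f G) (map f G') :=
  match e with
  | ext_refl => ext_refl
  | ext_cons A e => ext_cons (f A) (ext_map f e)
  end.

Lemma ext_ren_trans T (G G' G'' : list T) (e : ext G G') (e' : ext G' G'') A (x : var G A) :
  ext_ren (ext_trans e e') x = ext_ren e' (ext_ren e x).
Proof. induction e'; simpl; congruence. Qed.

Lemma ext_map_trans T U (f : T -> U) (G G' G'' : list T) (e : ext G G') (e' : ext G' G'') :
  ext_map f (ext_trans e e') = ext_trans (ext_map f e) (ext_map f e').
Proof. induction e'; simpl; congruence. Qed.

Lemma ext_ren_map T U (f : T -> U) (G G' : list T) (e : ext G G') A (x : var G A) :
  ext_ren (ext_map f e) (map_var f x) = map_var f (ext_ren e x).
Proof. induction e; simpl; congruence. Qed.

Lemma ext_length T (G G' : list T) (e : ext G G') : length G <= length G'.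
Proof. induction e; simpl; auto. Qed.

(** In the mixed cases a list would extend a strictly longer one. *)
Lemma ext_unique T (G G' : list T) (e e' : ext G G') : e = e'.
Proof.
  induction e as [|A G' e IH]; dependent destruction e'; auto.
  - exfalso. exact (PeanoNat.Nat.nle_succ_diag_l _ (ext_length e')).
  - exfalso. exact (PeanoNat.Nat.nle_succ_diag_l _ (ext_length e)).
  - f_equal. apply IH.
Qed.

(** * Substitution in the lambda-calculus *)

Section LambdaSubst.
Context {LK : Type}.
Implicit Types T : list (ty LK).

Lemma lren_id T s (M : tm T s) : lren M (fun _ x => x) = M.
Proof.
  induction M; simpl; rewrite ?lift_ren_id; congruence.
Qed.

Lemma lren_lren T s (M : tm T s) : forall T' T'' (r : renaming T T') (r' : renaming T' T''),
  lren (lren M r) r' = lren M (fun A x => r' A (r A x)).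
Proof.
  induction M; intros; simpl; rewrite ?IHM, ?IHM1, ?IHM2, ?lift_ren_comp; reflexivity.
Qed.

Lemma lren_ext_trans T T' T'' s (M : tm T s) (e : ext T T') (e' : ext T' T'') :
  lren (lren M (ext_ren e)) (ext_ren e') = lren M (ext_ren (ext_trans e e')).
Proof. rewrite lren_lren. f_equal. funvar. symmetry. apply ext_ren_trans. Qed.

Lemma llift_lift_ren T T' T'' u (r : renaming T T') (f : lsubst T' T'') :
  (fun s x => llift (u := u) f (lift_ren r x)) = llift (fun s x => f s (r s x)).
Proof. funvar; reflexivity. Qed.

Lemma lsub_lren T s (M : tm T s) : forall T' T'' (r : renaming T T') (f : lsubst T' T''),
  lsub (lren M r) f = lsub M (fun A x => f A (r A x)).
Proof.
  induction M; intros; simpl; rewrite ?IHM, ?IHM1, ?IHM2, ?llift_lift_ren; reflexivity.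
Qed.

Lemma lren_llift T T' T'' u (f : lsubst T T') (r : renaming T' T'') :
  (fun s x => lren (llift (u := u) f x) (lift_ren r)) = llift (fun s x => lren (f s x) r).
Proof.
  funvar; auto. unfold llift, lwk; simpl. rewrite !lren_lren. reflexivity.
Qed.

Lemma lren_lsub T s (M : tm T s) : forall T' T'' (f : lsubst T T') (r : renaming T' T''),
  lren (lsub M f) r = lsub M (fun A x => lren (f A x) r).
Proof.
  induction M; intros; simpl; rewrite ?IHM, ?IHM1, ?IHM2, ?lren_llift; reflexivity.
Qed.

Lemma lsub_llift T T' T'' u (f : lsubst T T') (g : lsubst T' T'') :
  (fun s x => lsub (llift (u := u) f x) (llift g)) = llift (fun s x => lsub (f s x) g).
Proof.
  funvar; auto. unfold llift, lwk; simpl. rewrite lsub_lren, lren_lsub. reflexivity.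
Qed.

Lemma lsub_lsub T s (M : tm T s) : forall T' T'' (f : lsubst T T') (g : lsubst T' T''),
  lsub (lsub M f) g = lsub M (fun A x => lsub (f A x) g).
Proof.
  induction M; intros; simpl; rewrite ?IHM, ?IHM1, ?IHM2, ?lsub_llift; reflexivity.
Qed.

Lemma llift_id T u : llift (u := u) (fun s (x : var T s) => LVar x) = fun s x => LVar x.
Proof. funvar; reflexivity. Qed.

Lemma lsub_id T s (M : tm T s) : lsub M (fun _ x => LVar x) = M.
Proof.
  induction M; simpl; rewrite ?llift_id; congruence.
Qed.

(** The equation behind the beta step of the logical relation: a substituted, weakened and
    instantiated body is a single simultaneous substitution. *)
Lemma lsub1_llift T T' T'' s u (M : tm (u :: T) s) (f : lsubst T T')
  (r : renaming T' T'') (N : tm T'' u) :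
  lsub1 (lren (lsub M (llift f)) (lift_ren r)) N = lsub M (lcons N (fun s x => lren (f s x) r)).
Proof.
  unfold lsub1. rewrite lren_lsub, lren_llift, lsub_lsub. f_equal.
  funvar; auto. unfold llift, lwk; simpl. rewrite lsub_lren. apply lsub_id.
Qed.

Lemma leq_lren T s (M N : tm T s) : leq M N ->
  forall T' (r : renaming T T'), leq (lren M r) (lren N r).
Proof.
  induction 1; intros; simpl; try solve [constructor; auto].
  - eapply leq_trans; eauto.
  - replace (lren (lsub1 M N) r) with (lsub1 (lren M (lift_ren r)) (lren N r)).
    + apply leq_lam_beta.
    + unfold lsub1. rewrite lren_lsub, lsub_lren. f_equal. funvar; reflexivity.
  - unfold lwk. rewrite lren_lren.
    replace (lren M (fun A x => lift_ren (B := s) r (vs x))) with (lwk s (lren M r)).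
    + apply leq_lam_eta.
    + unfold lwk. rewrite lren_lren. reflexivity.
Qed.

End LambdaSubst.

(** * Substitution in the enriched effect calculus *)

(** Inversion at an empty stoup, phrased with [eq_rect] so that destructing the equations replaces
    both [D] and [d]. *)
Lemma stsubst_none VK CK (G : list (vty VK CK)) D (d : stsubst G None D) :
  exists e : None = D, d = eq_rect None (stsubst G None) (SNone G) D e.
Proof. dependent destruction d. exists eq_refl. reflexivity. Qed.

Ltac invst :=
  repeat match goal with
  | d : stsubst _ None _ |- _ =>
      let e := fresh in destruct (stsubst_none d) as [e ->]; destruct e
  end; simpl.

Section EECSubst.
Context {VK CK : Type}.
Implicit Types (G : list (vty VK CK)) (D : option (cty VK CK)) (A B C : vty VK CK).

Definition stren G G' D D' (d : stsubst G D D') (r : renaming G G') : stsubst G' D D' :=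
  match d with
  | SNone _ => SNone G'
  | SSome u => SSome (eren u r)
  end.

Definition stcomp G G' D D' D'' (f : esubst G G') (d : stsubst G D D') :
  stsubst G' D' D'' -> stsubst G' D D'' :=
  match d with
  | SNone _ => fun d' => d'
  | SSome u => fun d' => SSome (esub u f d')
  end.

Lemma stren_stid G G' D (r : renaming G G') : stren (stid G D) r = stid G' D.
Proof. destruct D; reflexivity. Qed.

Lemma stwk_stid G D B : stwk B (stid G D) = stid (B :: G) D.
Proof. exact (stren_stid D _). Qed.

Lemma stcomp_stid_l G G' D D' (f : esubst G G') (d : stsubst G' D D') :
  stcomp f (stid G D) d = d.
Proof. destruct d; reflexivity. Qed.

Lemma eren_eren G D A (t : etm G D A) :
  forall G' G'' (r : renaming G G') (r' : renaming G' G''),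
  eren (eren t r) r' = eren t (fun A x => r' A (r A x)).
Proof.
  induction t; intros; simpl; rewrite ?IHt, ?IHt1, ?IHt2, ?IHt3, ?lift_ren_comp; reflexivity.
Qed.

Lemma eren_id G D A (t : etm G D A) : eren t (fun _ x => x) = t.
Proof. induction t; simpl; rewrite ?lift_ren_id; congruence. Qed.

Lemma elift_lift_ren G G' G'' B (r : renaming G G') (f : esubst G' G'') :
  (fun A x => elift (B := B) f (lift_ren r x)) = elift (fun A x => f A (r A x)).
Proof. funvar; reflexivity. Qed.

Lemma esub_eren G D A (t : etm G D A) :
  forall G' G'' D' (r : renaming G G') (f : esubst G' G'') (d : stsubst G'' D D'),
  esub (eren t r) f d = esub t (fun A x => f A (r A x)) d.
Proof.
  induction t; intros; simpl; rewrite ?IHt, ?IHt1, ?IHt2, ?IHt3, ?elift_lift_ren; reflexivity.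
Qed.

Lemma eren_elift G G' G'' B (f : esubst G G') (r : renaming G' G'') :
  (fun A x => eren (elift (B := B) f x) (lift_ren r)) = elift (fun A x => eren (f A x) r).
Proof.
  funvar; auto. unfold elift, ewk; simpl. rewrite !eren_eren. reflexivity.
Qed.

Lemma stren_stwk G G' D D' B (d : stsubst G D D') (r : renaming G G') :
  stren (stwk B d) (lift_ren r) = stwk B (stren d r).
Proof. destruct d; simpl; auto. unfold ewk. rewrite !eren_eren. reflexivity. Qed.

Lemma eren_esub G D A (t : etm G D A) :
  forall G' G'' D' (f : esubst G G') (d : stsubst G' D D') (r : renaming G' G''),
  eren (esub t f d) r = esub t (fun A x => eren (f A x) r) (stren d r).
Proof.
  induction t; intros; invst; simpl; rewrite ?IHt, ?IHt1, ?IHt2, ?IHt3, ?eren_elift, ?stren_stwk; auto.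
  dependent destruction d; reflexivity.
Qed.

Lemma esub_elift G G' G'' B (f : esubst G G') (g : esubst G' G'') :
  (fun A x => esub (elift (B := B) f x) (elift g) (SNone _)) =
  elift (fun A x => esub (f A x) g (SNone _)).
Proof.
  funvar; auto. unfold elift, ewk; simpl. rewrite esub_eren, eren_esub. reflexivity.
Qed.

Lemma stcomp_stwk G G' D D' D'' B (g : esubst G G') (d : stsubst G D D')
  (d' : stsubst G' D' D'') :
  stcomp (elift (B := B) g) (stwk B d) (stwk B d') = stwk B (stcomp g d d').
Proof.
  destruct d; simpl; auto. unfold ewk. rewrite esub_eren, eren_esub. reflexivity.
Qed.

Lemma esub_esub G D A (t : etm G D A) :
  forall G' G'' D' D'' (f : esubst G G') (d : stsubst G' D D')
    (g : esubst G' G'') (d' : stsubst G'' D' D''),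
  esub (esub t f d) g d' = esub t (fun A x => esub (f A x) g (SNone _)) (stcomp g d d').
Proof.
  induction t; intros; invst; simpl; rewrite ?IHt, ?IHt1, ?IHt2, ?IHt3, ?esub_elift, ?stcomp_stwk; auto.
  dependent destruction d; reflexivity.
Qed.

Lemma elift_eids G B : elift (B := B) (eids (G := G)) = eids (G := B :: G).
Proof. funvar; reflexivity. Qed.

Lemma esub_id G D A (t : etm G D A) : esub t (eids (G := G)) (stid G D) = t.
Proof.
  induction t; simpl in *; rewrite ?elift_eids, ?stwk_stid;
    first [reflexivity | congruence].
Qed.

Lemma esub_id_none G A (t : etm G None A) : esub t (eids (G := G)) (SNone G) = t.
Proof. exact (esub_id t). Qed.

Lemma stsub1_estoup G (C : cty VK CK) A (t : etm G (Some C) A) : stsub1 t (EStoup G C) = t.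
Proof. exact (esub_id t). Qed.

Lemma stsub1_assoc G D (B C : cty VK CK) A (k : etm G (Some C) A) (v : etm G (Some B) C)
  (t : etm G D B) :
  stsub1 (stsub1 k v) t = stsub1 k (stsub1 v t).
Proof. unfold stsub1. rewrite esub_esub. reflexivity. Qed.

Lemma eren_stsub1 G G' D (B : cty VK CK) A (k : etm G (Some B) A) (t : etm G D B)
  (r : renaming G G') :
  eren (stsub1 k t) r = stsub1 (eren k r) (eren t r).
Proof. unfold stsub1. rewrite eren_esub, esub_eren. reflexivity. Qed.

Lemma esub1_elift G G' G'' D A B (t : etm (B :: G) D A) (f : esubst G G')
  (r : renaming G' G'') (u : etm G'' None B) :
  esub1 (eren (esub t (elift f) (stid _ D)) (lift_ren r)) u =
  esub t (econs u (fun A x => eren (f A x) r)) (stid _ D).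
Proof.
  unfold esub1.
  rewrite eren_esub, eren_elift, esub_esub, stren_stid, stcomp_stid_l. f_equal.
  funvar; auto. unfold elift, ewk; simpl. rewrite esub_eren. apply esub_id_none.
Qed.

Lemma eren_esub1 G G' D A B (t : etm (B :: G) D A) (u : etm G None B) (r : renaming G G') :
  eren (esub1 t u) r = esub1 (eren t (lift_ren r)) (eren u r).
Proof.
  unfold esub1. rewrite eren_esub, esub_eren, stren_stid. f_equal. funvar; reflexivity.
Qed.

Lemma eren_ewk G G' D A B (t : etm G D A) (r : renaming G G') :
  eren (ewk B t) (lift_ren r) = ewk B (eren t r).
Proof. unfold ewk. rewrite !eren_eren. reflexivity. Qed.

Lemma eeq_eren G D A (t u : etm G D A) : eeq t u ->
  forall G' (r : renaming G G'), eeq (eren t r) (eren u r).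
Proof.
  induction 1; intros; simpl;
    rewrite ?eren_stsub1, ?eren_esub1, ?eren_ewk; try solve [constructor; auto].
  - eapply eeq_trans; eauto.
  - pose proof (eeq_lettens_beta (eren t r) (eren s r) (eren u (lift_ren r))) as H.
    rewrite esub_eren in H. rewrite eren_esub.
    match type of H with eeq _ (esub _ ?f _) =>
      match goal with |- eeq _ (esub _ ?g _) => replace g with f; [exact H|] end end.
    funvar; reflexivity.
Qed.

(** Both sides are beta contracta of linear applications [ELApp (ELLam k) t], so congruence under
    stoup substitution follows from that of the term formers. *)
Lemma eeq_stsub1 G D (B C : cty VK CK) (k k' : etm G (Some B) C) (t t' : etm G D B) :
  eeq k k' -> eeq t t' -> eeq (stsub1 k t) (stsub1 k' t').
Proof.
  intros hk ht.
  eapply eeq_trans; [apply eeq_sym, eeq_llam_beta|].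
  eapply eeq_trans; [|apply eeq_llam_beta].
  apply eeq_lapp; auto using eeq_llam.
Qed.

End EECSubst.

(** * The dual set-theoretic model *)

Section Model.
Context {VK CK : Type} (K : CK -> Type).
Implicit Types (G : list (vty VK CK)) (D : option (cty VK CK)) (A : vty VK CK) (B C : cty VK CK).

(* [csem C] interprets [C] in the opposite of the category of sets, so that
   [CPlus] is a product, [CTens] a function space and [CWith] a sum.  Since
   [CI] is interpreted by a singleton, so is [VComp C], the set of functions
   from [csem C] to [csem CI]. *)
Fixpoint vsem A : Type :=
  match A with
  | VConst _ | VUnit | VComp _ => unit
  | VProd A A' => vsem A * vsem A'
  | VArr A A' => vsem A -> vsem A'
  | VLolli B C => csem C -> csem B
  end
with csem C : Type :=
  match C with
  | CConst c => K c
  | CUnit => Empty_set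
  | CWith B C => csem B + csem C
  | CArr A B => vsem A * csem B
  | CI | CBang _ | CZero => unit
  | CTens A B => vsem A -> csem B
  | CPlus B C => csem B * csem C
  end.

(** Linear maps are reversed: under a stoup [C], a term of type [B] denotes a function from [csem B]
    to [csem C]. A nonempty stoup admits only computation types, hence the empty set elsewhere. *)
Definition jsem D A : Type :=
  match D with
  | None => vsem A
  | Some C => match A with VComp B => csem B -> csem C | _ => Empty_set end
  end.

(** Composition with the linear map that [h] denotes; for an empty stoup the target is a
    singleton. *)
Definition cmap D B C : (csem C -> csem B) -> jsem D B -> jsem D C :=
  match D with
  | None => fun _ _ => tt
  | Some _ => fun h v c => v (h c)
  end.

Definition cstar D : jsem D CUnit :=
  match D with
  | None => tt
  | Some _ => fun v => match v with end
  end.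

Definition cpair D B C : jsem D B -> jsem D C -> jsem D (CWith B C) :=
  match D with
  | None => fun _ _ => tt
  | Some _ => fun v w x => match x with inl b => v b | inr c => w c end
  end.

Definition clam D A B : (vsem A -> jsem D B) -> jsem D (CArr A B) :=
  match D with
  | None => fun _ => tt
  | Some _ => fun v x => v (fst x) (snd x)
  end.

Definition env G := forall A, var G A -> vsem A.

Definition env_cons G A (a : vsem A) (g : env G) : env (A :: G) :=
  fun A' x =>
    match x in var G0 A0
      return match G0 with
             | [] => unit
             | A1 :: G1 => vsem A1 -> (forall A2, var G1 A2 -> vsem A2) -> vsem A0
             end with
    | vz => fun a _ => a
    | vs y => fun _ g => g _ y
    end a g.

Fixpoint tsem G D A (t : etm G D A) : env G -> jsem D A :=
  match t in etm G D A return env G -> jsem D A with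
  | EVar x => fun g => g _ x
  | EStar _ => fun _ => tt
  | EPair t u => fun g => (tsem t g, tsem u g)
  | EFst t => fun g => fst (tsem t g)
  | ESnd t => fun g => snd (tsem t g)
  | ELam t => fun g a => tsem t (env_cons a g)
  | EApp t u => fun g => (tsem t g) (tsem u g)
  | EStoup _ _ => fun _ b => b
  | ECStar _ D => fun _ => cstar D
  | ECPair t u => fun g => cpair (tsem t g) (tsem u g)
  | @ECFst _ _ _ _ B C t => fun g => cmap (B := CWith B C) inl (tsem t g)
  | @ECSnd _ _ _ _ B C t => fun g => cmap (B := CWith B C) inr (tsem t g)
  | ECLam t => fun g => clam (fun a => tsem t (env_cons a g))
  | @ECApp _ _ _ _ A B s t => fun g => cmap (B := CArr A B) (fun b => (tsem t g, b)) (tsem s g)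
  | ETop _ => fun _ => tt
  | ELetTop t u => fun g => cmap (B := CI) (fun _ => tt) (tsem t g)
  | EBang _ => fun _ => tt
  | @ELetBang _ _ _ _ A _ t u => fun g => cmap (B := CBang A) (fun _ => tt) (tsem t g)
  | @ETens _ _ _ _ A B t u => fun g => cmap (C := CTens A B) (fun k => k (tsem t g)) (tsem u g)
  | @ELetTens _ _ _ _ A B _ s t => fun g =>
      cmap (B := CTens A B) (fun c a => tsem t (env_cons a g) c) (tsem s g)
  | EAbort _ t => fun g => cmap (B := CZero) (fun _ => tt) (tsem t g)
  | @EInl _ _ _ _ B C t => fun g => cmap (C := CPlus B C) fst (tsem t g)
  | @EInr _ _ _ _ B C t => fun g => cmap (C := CPlus B C) snd (tsem t g)
  | @ECase _ _ _ _ B C _ s t u => fun g =>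
      cmap (B := CPlus B C) (fun c => (tsem t g c, tsem u g c)) (tsem s g)
  | ELLam t => fun g => tsem t g
  | ELApp s t => fun g => cmap (tsem s g) (tsem t g)
  end.

(** * Substitution lemma and soundness of the model *)

Lemma env_cons_lift_ren G G' A (a : vsem A) (g : env G') (r : renaming G G') :
  (fun A' x => env_cons a g (lift_ren r x)) = env_cons a (fun A' x => g A' (r A' x)).
Proof. funvar; reflexivity. Qed.

Lemma tsem_eren G D A (t : etm G D A) : forall G' (r : renaming G G') (g : env G'),
  tsem (eren t r) g = tsem t (fun A' x => g A' (r A' x)).
Proof.
  induction t; intros; simpl; rewrite ?IHt, ?IHt1, ?IHt2, ?IHt3; try reflexivity.
  - extensionality a. rewrite IHt, env_cons_lift_ren. reflexivity.
  - f_equal. extensionality a. rewrite IHt, env_cons_lift_ren. reflexivity.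
  - f_equal. extensionality c. extensionality a. rewrite IHt2, env_cons_lift_ren. reflexivity.
Qed.

(** The semantic counterpart of stoup substitution: composition with the map denoted by the term
    that replaces the stoup. *)
Definition jact G D D' (d : stsubst G D D') (g : env G) A : jsem D A -> jsem D' A :=
  match d in stsubst _ D D' return jsem D A -> jsem D' A with
  | SNone _ => fun v => v
  | @SSome _ _ _ C D' u =>
      match A return jsem (Some C) A -> jsem D' A with
      | VComp B => fun v => cmap v (tsem u g)
      | _ => fun v => match v with end
      end
  end.

Lemma jact_cmap G D D' (d : stsubst G D D') (g : env G) B C (h : csem C -> csem B)
  (v : jsem D B) :
  jact d g (cmap h v) = cmap h (jact d g v).
Proof. destruct d as [|C' [D'|] u]; reflexivity. Qed.

Lemma jact_cpair G D D' (d : stsubst G D D') (g : env G) B C (v : jsem D B) (w : jsem D C) :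
  jact d g (cpair v w) = cpair (jact d g v) (jact d g w).
Proof.
  destruct d as [|C' [D'|] u]; try reflexivity.
  simpl. extensionality x. destruct x; reflexivity.
Qed.

Lemma jact_stid G D (g : env G) A (v : jsem D A) : jact (stid G D) g v = v.
Proof. destruct D; [destruct A|]; try destruct v; reflexivity. Qed.

Lemma jact_stwk G D D' (d : stsubst G D D') (g : env G) A A' (a : vsem A') (v : jsem D A) :
  jact (stwk A' d) (env_cons a g) v = jact d g v.
Proof.
  destruct d as [|C' D' u]; auto. destruct A; simpl; auto.
  unfold ewk. rewrite tsem_eren. reflexivity.
Qed.

Lemma env_cons_elift G G' A (a : vsem A) (g : env G') (f : esubst G G') :
  (fun A' x => tsem (elift f x) (env_cons a g)) =
  env_cons a (fun A' x => tsem (f A' x) g).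
Proof.
  funvar; auto. unfold elift, ewk; simpl. rewrite tsem_eren. reflexivity.
Qed.

Lemma tsem_esub G D A (t : etm G D A) :
  forall G' D' (f : esubst G G') (d : stsubst G' D D') (g : env G'),
  tsem (esub t f d) g = jact d g (tsem t (fun A' x => tsem (f A' x) g)).
Proof.
  induction t; intros; invst; simpl;
    rewrite ?jact_cmap, ?jact_cpair, ?IHt, ?IHt1, ?IHt2, ?IHt3, ?jact_stid;
    try reflexivity.
  - extensionality a. rewrite IHt, env_cons_elift. reflexivity.
  - dependent destruction d. destruct D'; simpl; try reflexivity.
    destruct (tsem e g). reflexivity.
  - dependent destruction d; simpl; [reflexivity|].
    destruct D' as [D'|]; simpl; [|reflexivity].
    extensionality x. destruct x.
  - replace (fun a => tsem (esub t (elift f) (stwk A d)) (env_cons a g)) with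
      (fun a => jact d g (tsem t (env_cons a (fun A' x => tsem (f A' x) g)))).
    + destruct d as [|C' [D'|] u]; reflexivity.
    + extensionality a. rewrite IHt, env_cons_elift, jact_stwk. reflexivity.
  - f_equal. extensionality c. extensionality a.
    rewrite IHt2, env_cons_elift. reflexivity.
Qed.

Lemma tsem_esub1 G D A A' (t : etm (A' :: G) D A) (u : etm G None A') (g : env G) :
  tsem (esub1 t u) g = tsem t (env_cons (tsem u g) g).
Proof.
  unfold esub1. rewrite tsem_esub, jact_stid. f_equal. funvar; reflexivity.
Qed.

Lemma tsem_stsub1 G D B C (t : etm G (Some C) B) (u : etm G D C) (g : env G) :
  tsem (stsub1 t u) g = cmap (tsem t g) (tsem u g).
Proof. unfold stsub1. rewrite tsem_esub. reflexivity. Qed.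

Lemma tsem_ewk G D A A' (t : etm G D A) (a : vsem A') (g : env G) :
  tsem (ewk A' t) (env_cons a g) = tsem t g.
Proof. unfold ewk. rewrite tsem_eren. reflexivity. Qed.

Lemma cmap_ext D B C (h h' : csem C -> csem B) (v : jsem D B) :
  (forall c, h c = h' c) -> cmap h v = cmap h' v.
Proof. intros e. f_equal. extensionality c. apply e. Qed.

Lemma unit_eq (x y : unit) : x = y.
Proof. destruct x, y. reflexivity. Qed.

Lemma tsem_eeq G D A (t u : etm G D A) : eeq t u -> forall g, tsem t g = tsem u g.
Proof.
  induction 1; intros g; simpl;
    rewrite ?tsem_stsub1, ?tsem_esub1, ?IHeeq, ?IHeeq1, ?IHeeq2, ?IHeeq3;
    try reflexivity; try apply unit_eq.
  - extensionality a. apply IHeeq.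
  - f_equal. extensionality a. apply IHeeq.
  - apply cmap_ext. intros c. extensionality a. rewrite IHeeq2. reflexivity.
  - symmetry. apply surjective_pairing.
  - extensionality a. rewrite tsem_ewk. reflexivity.
  - destruct D as [D|]; [|apply unit_eq]. extensionality c. destruct c.
  - destruct D as [D|]; [reflexivity|apply unit_eq].
  - destruct D as [D|]; [reflexivity|apply unit_eq].
  - destruct D as [D|]; [|apply unit_eq]. extensionality x. destruct x; reflexivity.
  - destruct D as [D|]; [reflexivity|apply unit_eq].
  - destruct D as [D|]; [|apply unit_eq]. extensionality x. destruct x as [a b]. simpl.
    rewrite tsem_ewk. reflexivity.
  - apply cmap_ext. intros c. apply unit_eq.
  - apply cmap_ext. intros c. apply unit_eq.
  - rewrite tsem_esub. simpl.
    replace (fun A' x => _) with (env_cons (tsem t g) g) by (funvar; reflexivity).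
    destruct D as [D|]; reflexivity.
  - apply cmap_ext. intros c. extensionality a.
    rewrite tsem_stsub1. simpl. rewrite tsem_ewk. reflexivity.
  - apply cmap_ext. intros c. apply unit_eq.
  - destruct D as [D|]; reflexivity.
  - destruct D as [D|]; reflexivity.
  - apply cmap_ext. intros c. simpl. symmetry. apply surjective_pairing.
Qed.

End Model.

(** * Faithfulness *)

Section Faithful.
Context {VK CK LK : Type} (und : LK -> CK).
Context (und_inj : forall a b : LK, und a = und b -> a = b).
Context (R : cty VK CK).

(* A set of terms for each context: the readback of a semantic value, from which
   the intended term is selected once the ambient context is known. *)
Definition liftable (s : ty LK) := forall T, tm T s -> Prop.

(** A constant of EEC need not come from the lambda-calculus, so the family ranges over the
    preimages of [c] under [und]; by injectivity there is at most one. *)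
Definition Kterm (c : CK) : Type := forall a, und a = c -> liftable (TConst a).

(** Meanings of type [ln_neg s] are functions out of [csem R]; they are evaluated at this point. *)
Context (pt : csem Kterm R).

Notation sem s := (csem Kterm (ln_ty und R s)).

(** The variable bound over [T], visible only in contexts that extend [s :: T]; elsewhere the set is
    empty. *)
Definition fresh_var T s : liftable s :=
  fun T' N => exists e : ext (s :: T) T', leq N (LVar (ext_ren e vz)).

Definition lift_fst s t (P : liftable (TProd s t)) : liftable s :=
  fun T N => exists M, P T M /\ leq N (LFst M).

Definition lift_snd s t (P : liftable (TProd s t)) : liftable t :=
  fun T N => exists M, P T M /\ leq N (LSnd M).

Definition lift_app s t (P : liftable (TArr s t)) (Q : liftable s) : liftable t :=
  fun T N => exists M M', P T M /\ Q T M' /\ leq N (LApp M M').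

(** Normalisation by evaluation without normal forms: membership of a term in [reify d] is tested by
    eta-expanding it down to constants. At an arrow the fresh variable is chosen from the context of
    the term under test. Function arguments are thunks over [csem R], forced at [pt] when read
    back. *)
Fixpoint reify s : sem s -> liftable s :=
  match s with
  | TConst a => fun d => d a eq_refl
  | TUnit => fun _ _ _ => True
  | TProd s t => fun d T N => reify (fst d) (LFst N) /\ reify (snd d) (LSnd N)
  | TArr s t => fun d T N =>
      reify (d (fun _ => reflect (fresh_var T (s := s)))) (LApp (lwk s N) (LVar vz))
  end
with reflect s : liftable s -> sem s :=
  match s with
  | TConst a => fun P b e T N => P T (eq_rect b (fun c => tm T (TConst c)) N a (und_inj e))
  | TUnit => fun _ => tt
  | TProd s t => fun P => (reflect (lift_fst P), reflect (lift_snd P))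
  | TArr s t => fun P d => reflect (lift_app P (reify (d pt)))
  end.

(** * Logical relation between meanings and lambda-terms *)

Definition represents T s (P : liftable s) (M : tm T s) :=
  forall T' (e : ext T T') N, P T' N <-> leq N (lren M (ext_ren e)).

Fixpoint denotes s : forall T, sem s -> tm T s -> Prop :=
  match s with
  | TConst a => fun T d M => represents (d a eq_refl) M
  | TUnit => fun _ _ _ => True
  | TProd s t => fun T d M => denotes (fst d) (LFst M) /\ denotes (snd d) (LSnd M)
  | TArr s t => fun T f M =>
      forall T' (e : ext T T') d N,
      denotes (d pt) N -> denotes (f d) (LApp (lren M (ext_ren e)) N)
  end.

Lemma denotes_leq s : forall T (d : sem s) (M N : tm T s),
  leq M N -> denotes d M -> denotes d N.
Proof.
  induction s; simpl; intros T d M N h; auto.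
  - intros hd T' e P. rewrite (hd T' e P).
    split; intros h'; (eapply leq_trans; [exact h'|]); apply leq_lren; auto using leq_sym.
  - intros [h1 h2]; split; [eapply IHs1|eapply IHs2]; try eassumption;
      auto using leq_fst, leq_snd.
  - intros hd T' e d' P hP. eapply IHs2; [|apply hd, hP].
    apply leq_app; [apply leq_lren, h|apply leq_refl].
Qed.

Lemma denotes_ext s : forall T T' (e : ext T T') (d : sem s) (M : tm T s),
  denotes d M -> denotes d (lren M (ext_ren e)).
Proof.
  induction s; simpl; intros T T' e d M hd; auto.
  - intros T'' e' N. rewrite lren_ext_trans. apply hd.
  - destruct hd as [h1 h2]; split; [apply (IHs1 _ _ e) in h1|apply (IHs2 _ _ e) in h2]; auto.
  - intros T'' e' d' N hN. rewrite lren_ext_trans. apply hd, hN.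
Qed.

Lemma represents_fresh_var T s : represents (fresh_var T (s := s)) (LVar (T := s :: T) vz).
Proof.
  intros T' e N. split.
  - intros [e' h]. rewrite (ext_unique e e'). exact h.
  - intros h. exists e. exact h.
Qed.

(** The two halves need each other: at an arrow, reading back a function reflects a fresh variable,
    and reflecting a term reads back its argument. The eta rules recover a term from its components
    or from its value at a fresh variable. *)
Lemma reify_reflect s :
  (forall T (d : sem s) (M : tm T s), denotes d M -> represents (reify d) M) /\
  (forall T (P : liftable s) (M : tm T s), represents P M -> denotes (reflect P) M).
Proof.
  induction s as [a| |s1 [IHr1 IHd1] s2 [IHr2 IHd2]|s1 [IHr1 IHd1] s2 [IHr2 IHd2]];
    simpl; split; intros T d M hd; auto.
  (* Injectivity at [eq_refl] yields a proof of [a = a]; by uniqueness of identity proofs the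
     transport along it is trivial. *)
  - intros T' e N. rewrite (UIP_refl _ _ (und_inj eq_refl)). apply hd.
  - intros T' e N. split; auto. intros _.
    eapply leq_trans; [apply leq_unit_eta|apply leq_sym, leq_unit_eta].
  - destruct hd as [h1 h2]. intros T' e N. simpl.
    rewrite (IHr1 _ _ _ h1 T' e), (IHr2 _ _ _ h2 T' e). simpl. split.
    + intros [e1 e2].
      eapply leq_trans; [apply leq_sym, leq_pair_eta|].
      eapply leq_trans; [|apply leq_pair_eta].
      auto using leq_pair.
    + auto using leq_fst, leq_snd.
  - split; [apply IHd1|apply IHd2]; intros T' e N; split.
    + intros (P & hP & hN). apply (hd T' e) in hP.
      eapply leq_trans; [exact hN|]. apply leq_fst, hP.
    + intros hN. exists (lren M (ext_ren e)). split; [apply (hd T' e), leq_refl|exact hN].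
    + intros (P & hP & hN). apply (hd T' e) in hP.
      eapply leq_trans; [exact hN|]. apply leq_snd, hP.
    + intros hN. exists (lren M (ext_ren e)). split; [apply (hd T' e), leq_refl|exact hN].
  - intros T' e N.
    (* The hypothesis is used one variable deeper, at the world [s1 :: T'], on the reflected fresh
       variable. *)
    pose proof (hd _ (ext_cons s1 e) (fun _ => reflect (fresh_var T' (s := s1))) (LVar vz)
                  (IHd1 _ _ _ (@represents_fresh_var T' s1))) as h.
    rewrite (IHr2 _ _ _ h _ ext_refl). simpl. rewrite lren_id.
    replace (lren M (fun A x => vs (ext_ren e x))) with (lwk s1 (lren M (ext_ren e)))
      by apply lren_lren.
    split.
    + intros h'.
      eapply leq_trans; [apply leq_sym, leq_lam_eta|].
      eapply leq_trans; [|apply leq_lam_eta].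
      apply leq_lam, h'.
    + intros h'. apply leq_app; [apply leq_lren, h'|apply leq_refl].
  - intros T' e d' N hN. apply IHd2. intros T'' e' P. simpl. rewrite lren_ext_trans. split.
    + intros (P1 & P2 & h1 & h2 & h3). eapply leq_trans; [exact h3|].
      apply leq_app; [apply (hd T'' (ext_trans e e')), h1|].
      apply (IHr1 _ _ _ hN T'' e'), h2.
    + intros h3. eexists _, _. split; [apply (hd T'' (ext_trans e e')), leq_refl|]. split; [|exact h3].
      apply (IHr1 _ _ _ hN T'' e'), leq_refl.
Qed.

(** Fundamental lemma of the logical relation; closure under beta expansion handles pairs and
    abstractions. *)
Lemma tsem_ln_tm_denotes T s (M : tm T s) :
  forall T' (f : lsubst T T') (g : env Kterm (ln_ctx und R T)),
  (forall s (x : var T s), denotes (g _ (map_var (ln_neg und R) x) pt) (f s x)) ->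
  denotes (tsem (ln_tm und R M) g pt) (lsub M f).
Proof.
  induction M; intros T' f g hg; simpl.
  - apply hg.
  - exact I.
  - split.
    + eapply denotes_leq; [apply leq_sym, leq_fst_beta|]. apply (IHM1 _ _ _ hg).
    + eapply denotes_leq; [apply leq_sym, leq_snd_beta|]. apply (IHM2 _ _ _ hg).
  - apply (IHM _ _ _ hg).
  - apply (IHM _ _ _ hg).
  - intros T'' e d N hN.
    eapply denotes_leq; [apply leq_sym, leq_lam_beta|].
    rewrite lsub1_llift. apply IHM. apply var_case; [exact hN|].
    intros. apply denotes_ext, hg.
  - specialize (IHM1 _ _ _ hg). simpl in IHM1.
    specialize (IHM1 _ ext_refl _ _ (IHM2 _ _ _ hg)). simpl in IHM1.
    rewrite lren_id in IHM1. exact IHM1.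
Qed.

(** Each variable is interpreted by its own reflection at the context where it is bound, and carried
    to larger contexts by [denotes_ext]. *)
Lemma env_denotes_vars T :
  exists g : env Kterm (ln_ctx und R T),
  forall s (x : var T s), denotes (g _ (map_var (ln_neg und R) x) pt) (LVar x).
Proof.
  induction T as [|s T [g hg]].
  - exists (fun A x => match x in var G _ return match G with [] => vsem Kterm A | _ => unit end with
                       | vz => tt | vs _ => tt end).
    intros s x. inversion x.
  - exists (env_cons (A := ln_neg und R s) (fun _ => reflect (fresh_var T (s := s))) g).
    apply var_case; simpl.
    + apply reify_reflect, represents_fresh_var.
    + intros s' y. apply (denotes_ext (ext_cons s ext_refl) (M := LVar y)), hg.
Qed.

Lemma ln_tm_faithful T s (M N : tm T s) : eeq (ln_tm und R M) (ln_tm und R N) -> leq M N.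
Proof.
  intros h. destruct (env_denotes_vars T) as [g hg].
  pose proof (tsem_ln_tm_denotes M hg) as hM.
  pose proof (tsem_ln_tm_denotes N hg) as hN.
  rewrite lsub_id in hM, hN. rewrite (tsem_eeq h) in hM.
  (* The common meaning reads back both to the class of [M] and to that of [N]. *)
  apply (proj1 (reify_reflect s)) in hM, hN.
  specialize (hM _ ext_refl M). specialize (hN _ ext_refl M).
  simpl in hM, hN. rewrite lren_id in hM, hN. apply hN, hM, leq_refl.
Qed.

End Faithful.

(** * Fullness *)

Section Full.
Context {VK CK LK : Type} (und : LK -> CK) (R : cty VK CK).

Notation lnctx T := (ln_ctx und R T).

(** * Definable linear maps and their weakening *)

Lemma ln_tm_lren T s (M : tm T s) :
  forall T' (r : renaming T T') (r' : renaming (lnctx T) (lnctx T')),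
  (forall u (x : var T u), r' _ (map_var (ln_neg und R) x) = map_var (ln_neg und R) (r _ x)) ->
  ln_tm und R (lren M r) = eren (ln_tm und R M) r'.
Proof.
  induction M; intros T' r r' h; simpl;
    rewrite ?(IHM _ _ _ h), ?(IHM1 _ _ _ h), ?(IHM2 _ _ _ h), ?h; try reflexivity.
  rewrite (IHM (s :: T') _ (lift_ren (B := ln_neg und R s) r')); [reflexivity|].
  apply var_case; simpl; [reflexivity|]. intros. rewrite h. reflexivity.
Qed.

Definition eext T T' (e : ext T T') D A (t : etm (lnctx T) D A) : etm (lnctx T') D A :=
  eren t (ext_ren (ext_map (ln_neg und R) e)).

Lemma eext_refl T D A (t : etm (lnctx T) D A) : eext ext_refl t = t.
Proof. apply eren_id. Qed.

Lemma eext_trans T T' T'' (e : ext T T') (e' : ext T' T'') D A (t : etm (lnctx T) D A) :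
  eext e' (eext e t) = eext (ext_trans e e') t.
Proof.
  unfold eext. rewrite eren_eren. f_equal. funvar.
  rewrite ext_map_trans. symmetry. apply ext_ren_trans.
Qed.

Lemma eext_stsub1 T T' (e : ext T T') D (B : cty VK CK) A (k : etm (lnctx T) (Some B) A)
  (t : etm (lnctx T) D B) :
  eext e (stsub1 k t) = stsub1 (eext e k) (eext e t).
Proof. apply eren_stsub1. Qed.

Lemma eext_eeq T T' (e : ext T T') D A (t u : etm (lnctx T) D A) :
  eeq t u -> eeq (eext e t) (eext e u).
Proof. intros h. apply eeq_eren, h. Qed.

Lemma ln_tm_eext T T' (e : ext T T') s (M : tm T s) :
  ln_tm und R (lren M (ext_ren e)) = eext e (ln_tm und R M).
Proof. apply ln_tm_lren. intros. apply ext_ren_map. Qed.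

(** The maps [k |-> M^ln{k}], with the stoup in the role of [k]. *)
Definition definable T s (k : etm (lnctx T) (Some (ln_ty und R s)) R) :=
  exists M : tm T s, eeq (ELApp (ln_tm und R M) (EStoup _ (ln_ty und R s))) k.

(** An inductive family makes sense at every constant [c] without deciding whether [c] lies in the
    range of [und]. *)
Inductive definable_const T : forall c, etm (lnctx T) (Some (CConst c)) R -> Prop :=
| definable_const_intro : forall a k, definable (s := TConst a) k -> definable_const (c := und a) k.

Lemma definable_eeq T s (t u : etm (lnctx T) (Some (ln_ty und R s)) R) :
  eeq t u -> definable t -> definable u.
Proof. intros h [M hM]. exists M. eapply eeq_trans; eassumption. Qed.

Lemma definable_eext T T' (e : ext T T') s (t : etm (lnctx T) (Some (ln_ty und R s)) R) :
  definable t -> definable (eext e t).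
Proof.
  intros [M hM]. exists (lren M (ext_ren e)). rewrite ln_tm_eext. exact (eext_eeq e hM).
Qed.

Lemma definable_const_eeq T c (t u : etm (lnctx T) (Some (CConst c)) R) :
  eeq t u -> definable_const t -> definable_const u.
Proof.
  intros h ht. revert u h. destruct ht as [a k hk]. intros u h.
  constructor. exact (definable_eeq (s := TConst a) h hk).
Qed.

Lemma definable_const_eext T T' (e : ext T T') c (t : etm (lnctx T) (Some (CConst c)) R) :
  definable_const t -> definable_const (eext e t).
Proof. intros [a k hk]. constructor. exact (definable_eext e hk). Qed.

Lemma definable_const_range T c (k : etm (lnctx T) (Some (CConst c)) R) :
  definable_const k -> exists a, c = und a.
Proof. intros [a k' _]. exists a. reflexivity. Qed.

(** The index is generalised together with an equation to [und a]; injectivity identifies the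
    preimages and uniqueness of identity proofs removes the transport. *)
Lemma definable_const_und (und_inj : forall a b : LK, und a = und b -> a = b) T a
  (k : etm (lnctx T) (Some (CConst (und a))) R) :
  definable_const k <-> definable (s := TConst a) k.
Proof.
  split; [|constructor; assumption].
  cut (forall c (k : etm (lnctx T) (Some (CConst c)) R), definable_const k ->
        forall e : c = und a,
        definable (s := TConst a)
          (eq_rect c (fun c => etm (lnctx T) (Some (CConst c)) R) k (und a) e)).
  { intros h hk. exact (h _ _ hk eq_refl). }
  intros c k' [b k'' hk] e. destruct (und_inj _ _ e).
  rewrite (UIP_refl _ _ e). exact hk.
Qed.

(** [Q] holds of the admissible terms of type [R] with empty stoup, [K] of the admissible linear
    maps from a constant to [R]. Both stay abstract so that the two choices of [R] share one
    argument. *)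
Context (Q : forall T, etm (lnctx T) None R -> Prop).
Context (K : forall T c, etm (lnctx T) (Some (CConst c)) R -> Prop).
Context (Q_eeq : forall T (t u : etm (lnctx T) None R), eeq t u -> Q t -> Q u).
Context (Q_ext : forall T T' (e : ext T T') (t : etm (lnctx T) None R), Q t -> Q (eext e t)).
Context (K_eeq : forall T c (t u : etm (lnctx T) (Some (CConst c)) R), eeq t u -> K t -> K u).
Context (K_ext : forall T T' (e : ext T T') c (t : etm (lnctx T) (Some (CConst c)) R),
  K t -> K (eext e t)).

(* At a computation type [C] the logical predicate classifies not the terms of
   type [C] but the linear maps from [C] to [R]; hence [CPlus] becomes a
   conjunction, [CWith] a disjunction and [CTens] an implication. *)
Fixpoint vpred (A : vty VK CK) : forall T, etm (lnctx T) None A -> Prop :=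
  match A with
  | VConst _ | VUnit => fun _ _ => True
  | VProd A A' => fun T t => vpred (EFst t) /\ vpred (ESnd t)
  | VArr A A' => fun T t =>
      forall T' (e : ext T T') a, vpred a -> vpred (EApp (eext e t) a)
  | VComp C => fun T t =>
      forall T' (e : ext T T') k, cpred k -> Q (stsub1 k (eext e t))
  | VLolli B C => fun T t =>
      forall T' (e : ext T T') k, cpred k -> cpred (stsub1 k (ELApp (eext e t) (EStoup _ B)))
  end
with cpred (C : cty VK CK) : forall T, etm (lnctx T) (Some C) R -> Prop :=
  match C with
  | CConst c => fun T k => K k
  | CUnit => fun _ _ => False
  | CWith B C => fun T k =>
      (exists k', cpred k' /\ eeq k (stsub1 k' (ECFst (EStoup _ (CWith B C))))) \/
      (exists k', cpred k' /\ eeq k (stsub1 k' (ECSnd (EStoup _ (CWith B C)))))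
  | CArr A B => fun T k =>
      exists a k', vpred a /\ cpred k' /\ eeq k (stsub1 k' (ECApp (EStoup _ (CArr A B)) a))
  | CI => fun T k => Q (stsub1 k (ETop _))
  | CBang A => fun T k =>
      forall T' (e : ext T T') a, vpred a -> Q (stsub1 (eext e k) (EBang a))
  | CTens A B => fun T k =>
      forall T' (e : ext T T') a, vpred a -> cpred (stsub1 (eext e k) (ETens a (EStoup _ B)))
  | CZero => fun _ _ => True
  | CPlus B C => fun T k =>
      cpred (stsub1 k (EInl C (EStoup _ B))) /\ cpred (stsub1 k (EInr B (EStoup _ C)))
  end.

Scheme vty_mut := Induction for vty Sort Prop
  with cty_mut := Induction for cty Sort Prop.
Combined Scheme vty_cty_ind from vty_mut, cty_mut.

Lemma pred_eeq :
  (forall (A : vty VK CK) T (t u : etm (lnctx T) None A), eeq t u -> vpred t -> vpred u) /\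
  (forall (C : cty VK CK) T (t u : etm (lnctx T) (Some C) R), eeq t u -> cpred t -> cpred u).
Proof.
  apply vty_cty_ind; simpl; auto.
  - intros A IHA B IHB T t u h [h1 h2]. split; [eapply IHA|eapply IHB]; try eassumption.
    + apply eeq_fst, h.
    + apply eeq_snd, h.
  - intros A IHA B IHB T t u h ht T' e a ha. eapply IHB; [|apply ht, ha].
    apply eeq_app; [apply eext_eeq, h|apply eeq_refl].
  - intros C IHC T t u h ht T' e k hk. eapply Q_eeq; [|apply ht, hk].
    apply eeq_stsub1; [apply eeq_refl|apply eext_eeq, h].
  - intros B IHB C IHC T t u h ht T' e k hk. eapply IHB; [|apply ht, hk].
    apply eeq_stsub1; [apply eeq_refl|]. apply eeq_lapp; [apply eext_eeq, h|apply eeq_refl].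
  - intros c T t u. apply K_eeq.
  - intros B IHB C IHC T t u h [(k & hk & ek)|(k & hk & ek)]; [left|right];
      exists k; (split; [exact hk|]); (eapply eeq_trans; [apply eeq_sym, h|exact ek]).
  - intros A IHA B IHB T t u h (a & k & ha & hk & ek). exists a, k.
    repeat (split; auto). eapply eeq_trans; [apply eeq_sym, h|exact ek].
  - intros T t u h. apply Q_eeq. apply eeq_stsub1; [exact h|apply eeq_refl].
  - intros A IHA T t u h ht T' e a ha. eapply Q_eeq; [|apply ht, ha].
    apply eeq_stsub1; [apply eext_eeq, h|apply eeq_refl].
  - intros A IHA B IHB T t u h ht T' e a ha. eapply IHB; [|apply ht, ha].
    apply eeq_stsub1; [apply eext_eeq, h|apply eeq_refl].
  - intros B IHB C IHC T t u h [h1 h2]. split; [eapply IHB|eapply IHC]; try eassumption;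
      (apply eeq_stsub1; [exact h|apply eeq_refl]).
Qed.

Lemma pred_ext :
  (forall (A : vty VK CK) T T' (e : ext T T') (t : etm (lnctx T) None A),
    vpred t -> vpred (eext e t)) /\
  (forall (C : cty VK CK) T T' (e : ext T T') (t : etm (lnctx T) (Some C) R),
    cpred t -> cpred (eext e t)).
Proof.
  apply vty_cty_ind; simpl; auto.
  - intros A IHA B IHB T T' e t [h1 h2]. split; [apply (IHA _ _ e _ h1)|apply (IHB _ _ e _ h2)].
  - intros A IHA B IHB T T' e t ht T'' e' a ha. rewrite eext_trans. auto.
  - intros C IHC T T' e t ht T'' e' k hk. rewrite eext_trans. auto.
  - intros B IHB C IHC T T' e t ht T'' e' k hk. rewrite eext_trans. auto.
  - intros B IHB C IHC T T' e t [(k & hk & ek)|(k & hk & ek)]; [left|right];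
      exists (eext e k); (split; [auto|]); apply (eext_eeq e) in ek;
      rewrite eext_stsub1 in ek; exact ek.
  - intros A IHA B IHB T T' e t (a & k & ha & hk & ek). exists (eext e a), (eext e k).
    repeat (split; auto). apply (eext_eeq e) in ek. rewrite eext_stsub1 in ek. exact ek.
  - intros T T' e t ht. apply (Q_ext e) in ht. rewrite eext_stsub1 in ht. exact ht.
  - intros A IHA T T' e t ht T'' e' a ha. rewrite eext_trans. auto.
  - intros A IHA B IHB T T' e t ht T'' e' a ha. rewrite eext_trans. auto.
  - intros B IHB C IHC T T' e t [h1 h2].
    apply (IHB _ _ e) in h1. apply (IHC _ _ e) in h2.
    rewrite eext_stsub1 in h1, h2. split; assumption.
Qed.

Definition opred D : forall T, etm (lnctx T) D R -> Prop :=
  match D with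
  | None => fun T t => Q t
  | Some C => fun T t => cpred t
  end.

(** Terms of computation type are judged by composing them with admissible maps to [R]. Allowing any
    stoup lets one induction cover both forms of judgement. *)
Definition jpred D A : forall T, etm (lnctx T) D A -> Prop :=
  match A with
  | VComp B => fun T t =>
      forall T' (e : ext T T') k, cpred k -> opred (stsub1 k (eext e t))
  | _ => match D with
         | None => fun T t => vpred t
         | Some _ => fun _ _ => False
         end
  end.

Lemma jpred_none A T (t : etm (lnctx T) None A) : jpred t <-> vpred t.
Proof. destruct A; reflexivity. Qed.

Lemma opred_eeq D T (t u : etm (lnctx T) D R) : eeq t u -> opred t -> opred u.
Proof. destruct D; [apply pred_eeq|apply Q_eeq]. Qed.

(** Many term formers are a linear map [k'] composed with a premise [t]; admissibility of [t] leaves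
    only a condition on [k] composed with [k']. *)
Lemma opred_stsub1 D T (B C : cty VK CK) (k : etm (lnctx T) (Some C) R)
  (k' : etm (lnctx T) (Some B) C) (t : etm (lnctx T) D B) :
  jpred t -> cpred (stsub1 k k') -> opred (stsub1 k (stsub1 k' t)).
Proof.
  intros ht hk. rewrite <- stsub1_assoc.
  specialize (ht _ ext_refl _ hk). rewrite eext_refl in ht. exact ht.
Qed.

Lemma jpred_ext D A T T' (e : ext T T') (t : etm (lnctx T) D A) : jpred t -> jpred (eext e t).
Proof.
  destruct A; try (destruct D; [intros []|exact (proj1 pred_ext _ _ _ e t)]).
  intros ht T'' e' k hk. rewrite eext_trans. auto.
Qed.

(** For [CWith] and [CArr], where an admissible map factors through an eliminator [v]: [v] composed
    with an introduction form is a beta redex. *)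
Lemma opred_eeq_stsub1 D T (B C : cty VK CK) (k : etm (lnctx T) (Some C) R)
  (k' : etm (lnctx T) (Some B) R) (v : etm (lnctx T) (Some C) B)
  (t : etm (lnctx T) D C) (u : etm (lnctx T) D B) :
  eeq k (stsub1 k' v) -> eeq (stsub1 v t) u -> opred (stsub1 k' u) -> opred (stsub1 k t).
Proof.
  intros hk hu. apply opred_eeq, eeq_sym.
  eapply eeq_trans; [apply eeq_stsub1; [exact hk|apply eeq_refl]|].
  rewrite stsub1_assoc. apply eeq_stsub1; [apply eeq_refl|exact hu].
Qed.

Lemma opred_jpred D T (B : cty VK CK) (k : etm (lnctx T) (Some B) R) (t : etm (lnctx T) D B) :
  cpred k -> jpred t -> opred (stsub1 k t).
Proof. intros hk ht. specialize (ht _ ext_refl _ hk). rewrite eext_refl in ht. exact ht. Qed.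

Definition eextl T T' (e : ext T T') B D A (t : etm (B :: lnctx T) D A) :
  etm (B :: lnctx T') D A :=
  eren t (lift_ren (ext_ren (ext_map (ln_neg und R) e))).

Lemma eextl_trans T T' T'' (e : ext T T') (e' : ext T' T'') B D A (t : etm (B :: lnctx T) D A) :
  eextl e' (eextl e t) = eextl (ext_trans e e') t.
Proof.
  unfold eextl. rewrite eren_eren, lift_ren_comp. do 2 f_equal. funvar.
  rewrite ext_map_trans. symmetry. apply ext_ren_trans.
Qed.

(** * Closure of the logical predicate under the term formers *)

Lemma jpred_cpair D T (B C : cty VK CK) (t : etm (lnctx T) D B) (u : etm (lnctx T) D C) :
  jpred t -> jpred u -> jpred (ECPair t u).
Proof.
  intros ht hu T' e k [(k' & hk & ek)|(k' & hk & ek)];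
    (eapply opred_eeq_stsub1; [exact ek| |]).
  - apply eeq_cfst_beta.
  - apply ht, hk.
  - apply eeq_csnd_beta.
  - apply hu, hk.
Qed.

Lemma jpred_cfst D T (B C : cty VK CK) (t : etm (lnctx T) D (CWith B C)) :
  jpred t -> jpred (ECFst t).
Proof.
  intros ht T' e k hk.
  apply (opred_stsub1 (k' := ECFst (EStoup _ _))); [apply jpred_ext, ht|].
  left. exists k. split; [exact hk|apply eeq_refl].
Qed.

Lemma jpred_csnd D T (B C : cty VK CK) (t : etm (lnctx T) D (CWith B C)) :
  jpred t -> jpred (ECSnd t).
Proof.
  intros ht T' e k hk.
  apply (opred_stsub1 (k' := ECSnd (EStoup _ _))); [apply jpred_ext, ht|].
  right. exists k. split; [exact hk|apply eeq_refl].
Qed.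

Lemma jpred_clam D T A (B : cty VK CK) (t : etm (A :: lnctx T) D B) :
  (forall T' (e : ext T T') a, vpred a -> jpred (esub1 (eextl e t) a)) -> jpred (ECLam t).
Proof.
  intros ht T' e k (a & k' & ha & hk & ek).
  eapply opred_eeq_stsub1; [exact ek| |].
  - unfold stsub1. simpl. rewrite esub_id_none. apply eeq_clam_beta.
  - apply opred_jpred; [exact hk|]. apply (ht T' e a ha).
Qed.

Lemma jpred_capp D T A (B : cty VK CK) (s : etm (lnctx T) D (CArr A B))
  (t : etm (lnctx T) None A) :
  jpred s -> vpred t -> jpred (ECApp s t).
Proof.
  intros hs ht T' e k hk.
  replace (eext e (ECApp s t)) with (stsub1 (ECApp (EStoup _ _) (eext e t)) (eext e s))
    by (unfold stsub1; simpl; rewrite esub_id_none; reflexivity).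
  apply opred_stsub1; [apply jpred_ext, hs|].
  exists (eext e t), k. split; [apply pred_ext, ht|]. split; [exact hk|apply eeq_refl].
Qed.

Lemma jpred_lettop D T (B : cty VK CK) (t : etm (lnctx T) D CI) (u : etm (lnctx T) None B) :
  jpred t -> vpred u -> jpred (ELetTop t u).
Proof.
  intros ht hu T' e k hk.
  replace (eext e (ELetTop t u)) with (stsub1 (ELetTop (EStoup _ _) (eext e u)) (eext e t))
    by (unfold stsub1; simpl; rewrite esub_id_none; reflexivity).
  apply opred_stsub1; [apply jpred_ext, ht|].
  simpl. rewrite stsub1_assoc. eapply Q_eeq; [|apply (hu T' e k hk)].
  apply eeq_stsub1; [apply eeq_refl|].
  unfold stsub1. simpl. rewrite esub_id_none. apply eeq_sym, eeq_lettop_beta.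
Qed.

Lemma jpred_letbang D T A (B : cty VK CK) (t : etm (lnctx T) D (CBang A))
  (u : etm (A :: lnctx T) None B) :
  jpred t ->
  (forall T' (e : ext T T') a, vpred a -> vpred (esub1 (eextl e u) a)) ->
  jpred (ELetBang t u).
Proof.
  intros ht hu T' e k hk.
  (* The let is the composite of a linear map with its subject, the form that [opred_stsub1]
     expects. *)
  assert (E : forall D' T'' (v : etm (A :: lnctx T'') None B) (w : etm (lnctx T'') D' (CBang A)),
            stsub1 (ELetBang (EStoup _ _) v) w = ELetBang w v)
    by (intros; unfold stsub1; simpl; rewrite elift_eids, esub_id_none; reflexivity).
  change (eext e (ELetBang t u)) with (ELetBang (eext e t) (eextl e u)). rewrite <- E.
  apply opred_stsub1; [apply jpred_ext, ht|].
  intros T'' e' a ha. rewrite eext_stsub1, stsub1_assoc.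
  change (eext e' (ELetBang (EStoup _ _) (eextl e u)))
    with (ELetBang (EStoup (lnctx T'') (CBang A)) (eextl e' (eextl e u))).
  rewrite E, eextl_trans. eapply Q_eeq.
  - apply eeq_stsub1; [apply eeq_refl|]. apply eeq_sym, eeq_letbang_beta.
  - apply (opred_jpred (D := None)); [apply pred_ext, hk|]. apply hu, ha.
Qed.

Lemma jpred_tens D T A (B : cty VK CK) (t : etm (lnctx T) None A) (u : etm (lnctx T) D B) :
  vpred t -> jpred u -> jpred (ETens t u).
Proof.
  intros ht hu T' e k hk.
  replace (eext e (ETens t u)) with (stsub1 (ETens (eext e t) (EStoup _ _)) (eext e u))
    by (unfold stsub1; simpl; rewrite esub_id_none; reflexivity).
  apply opred_stsub1; [apply jpred_ext, hu|].
  specialize (hk _ ext_refl (eext e t)). rewrite eext_refl in hk. apply hk, pred_ext, ht.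
Qed.

Lemma jpred_lettens D T A (B C : cty VK CK) (s : etm (lnctx T) D (CTens A B))
  (t : etm (A :: lnctx T) (Some B) C) :
  jpred s ->
  (forall T' (e : ext T T') a, vpred a -> jpred (esub1 (eextl e t) a)) ->
  jpred (ELetTens s t).
Proof.
  intros hs ht T' e k hk.
  assert (E : forall D' T'' (v : etm (A :: lnctx T'') (Some B) C)
            (w : etm (lnctx T'') D' (CTens A B)),
            stsub1 (ELetTens (EStoup _ _) v) w = ELetTens w v).
  { intros. unfold stsub1. simpl. rewrite elift_eids. f_equal. exact (esub_id v). }
  change (eext e (ELetTens s t)) with (ELetTens (eext e s) (eextl e t)). rewrite <- E.
  apply opred_stsub1; [apply jpred_ext, hs|].
  intros T'' e' a ha. rewrite eext_stsub1, stsub1_assoc.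
  change (eext e' (ELetTens (EStoup _ _) (eextl e t)))
    with (ELetTens (EStoup (lnctx T'') (CTens A B)) (eextl e' (eextl e t))).
  rewrite E, eextl_trans. eapply pred_eeq.
  - apply eeq_stsub1; [apply eeq_refl|]. apply eeq_sym, eeq_lettens_beta.
  - apply (opred_jpred (D := Some B)); [apply pred_ext, hk|]. apply (ht _ _ _ ha).
Qed.

Lemma jpred_abort D T (B : cty VK CK) (t : etm (lnctx T) D CZero) :
  jpred t -> jpred (EAbort B t).
Proof.
  intros ht T' e k hk.
  apply (opred_stsub1 (k' := EAbort B (EStoup _ _))); [apply jpred_ext, ht|exact I].
Qed.

Lemma jpred_inl D T (B C : cty VK CK) (t : etm (lnctx T) D B) :
  jpred t -> jpred (EInl C t).
Proof.
  intros ht T' e k [hk _].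
  apply (opred_stsub1 (k' := EInl C (EStoup _ _))); [apply jpred_ext, ht|exact hk].
Qed.

Lemma jpred_inr D T (B C : cty VK CK) (t : etm (lnctx T) D C) :
  jpred t -> jpred (EInr B t).
Proof.
  intros ht T' e k [_ hk].
  apply (opred_stsub1 (k' := EInr B (EStoup _ _))); [apply jpred_ext, ht|exact hk].
Qed.

Lemma jpred_case D T (A B C : cty VK CK) (s : etm (lnctx T) D (CPlus A B))
  (t : etm (lnctx T) (Some A) C) (u : etm (lnctx T) (Some B) C) :
  jpred s -> jpred t -> jpred u -> jpred (ECase s t u).
Proof.
  intros hs ht hu T' e k hk.
  assert (E : forall D' (w : etm (lnctx T') D' (CPlus A B)),
            stsub1 (ECase (EStoup _ _) (eext e t) (eext e u)) w =
            ECase w (eext e t) (eext e u)).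
  { intros. unfold stsub1. simpl. f_equal; [exact (esub_id (eext e t))|exact (esub_id (eext e u))]. }
  change (eext e (ECase s t u)) with (ECase (eext e s) (eext e t) (eext e u)). rewrite <- E.
  apply opred_stsub1; [apply jpred_ext, hs|].
  split; rewrite stsub1_assoc, E; eapply pred_eeq.
  - apply eeq_stsub1; [apply eeq_refl|]. apply eeq_sym, eeq_inl_beta.
  - rewrite stsub1_estoup. apply (ht T' e k hk).
  - apply eeq_stsub1; [apply eeq_refl|]. apply eeq_sym, eeq_inr_beta.
  - rewrite stsub1_estoup. apply (hu T' e k hk).
Qed.

Lemma jpred_lapp D T (B C : cty VK CK) (s : etm (lnctx T) None (VLolli B C))
  (t : etm (lnctx T) D B) :
  vpred s -> jpred t -> jpred (ELApp s t).
Proof.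
  intros hs ht T' e k hk.
  replace (eext e (ELApp s t)) with (stsub1 (ELApp (eext e s) (EStoup _ _)) (eext e t))
    by (unfold stsub1; simpl; rewrite esub_id_none; reflexivity).
  apply opred_stsub1; [apply jpred_ext, ht|]. apply (hs T' e k hk).
Qed.

Lemma vpred_llam T (B C : cty VK CK) (t : etm (lnctx T) (Some B) C) :
  jpred t -> vpred (ELLam t).
Proof.
  intros ht T' e k hk. eapply pred_eeq; [|apply (ht T' e k hk)].
  apply eeq_stsub1; [apply eeq_refl|].
  eapply eeq_trans; [|apply eeq_sym, eeq_llam_beta].
  rewrite stsub1_estoup. apply eeq_refl.
Qed.

Lemma vpred_lam T A A' (t : etm (A :: lnctx T) None A') :
  (forall T' (e : ext T T') a, vpred a -> vpred (esub1 (eextl e t) a)) -> vpred (ELam t).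
Proof.
  intros ht T' e a ha. eapply pred_eeq; [|apply (ht T' e a ha)].
  apply eeq_sym, eeq_lam_beta.
Qed.

(** Fundamental lemma of the logical predicate. Context variables receive admissible values; the
    stoup is left in place, since [jpred] already speaks of terms with a stoup. *)
Lemma jpred_esub G D A (t : etm G D A) :
  forall T (f : esubst G (lnctx T)),
  (forall A' (x : var G A'), vpred (f A' x)) -> jpred (esub t f (stid _ D)).
Proof.
  (* Binders: a weakened body instantiated at an admissible [a] is the body under an extended
     substitution that is still admissible pointwise. *)
  assert (hlift : forall G T T' (f : esubst G (lnctx T)) B D A (t : etm (B :: G) D A)
            (e : ext T T') (a : etm (lnctx T') None B),
            (forall T (f : esubst (B :: G) (lnctx T)),
              (forall A' (x : var _ A'), vpred (f A' x)) -> jpred (esub t f (stid _ D))) ->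
            (forall A' (x : var G A'), vpred (f A' x)) -> vpred a ->
            jpred (esub1 (eextl e (esub t (elift f) (stid _ D))) a)).
  { intros G' T T' f B D' A' u e a hu hf ha. unfold eextl. rewrite esub1_elift.
    apply hu. apply var_case; [exact ha|]. intros. apply pred_ext, hf. }
  induction t; intros T f hf; cbn [esub stid stcast stget] in *; rewrite ?stwk_stid; try apply jpred_none.
  - apply hf.
  - exact I.
  - split; (eapply pred_eeq; [apply eeq_sym|]).
    + apply eeq_fst_beta.
    + apply jpred_none, IHt1, hf.
    + apply eeq_snd_beta.
    + apply jpred_none, IHt2, hf.
  - apply (jpred_none (esub t f (SNone _))), IHt, hf.
  - apply (jpred_none (esub t f (SNone _))), IHt, hf.
  - apply vpred_lam. intros. apply jpred_none. apply (hlift _ _ _ _ _ None); auto.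
  - pose proof (IHt1 _ _ hf _ ext_refl _ (proj1 (jpred_none _) (IHt2 _ _ hf))) as h.
    rewrite eext_refl in h. exact h.
  - intros T' e k hk. change (eext e (EStoup (lnctx T) A)) with (EStoup (lnctx T') A).
    rewrite stsub1_estoup. exact hk.
  - intros T' e k [].
  - apply jpred_cpair; [apply IHt1, hf|apply IHt2, hf].
  - eapply jpred_cfst, IHt, hf.
  - eapply jpred_csnd, IHt, hf.
  - apply jpred_clam. intros. apply hlift; auto.
  - apply jpred_capp; [apply IHt1, hf|]. apply jpred_none, IHt2, hf.
  - intros T' e k hk. exact hk.
  - apply jpred_lettop; [apply IHt1, hf|]. apply jpred_none, IHt2, hf.
  - intros T' e k hk. specialize (hk _ ext_refl (eext e (esub t f (SNone _)))).
    rewrite eext_refl in hk. apply hk, pred_ext, jpred_none, IHt, hf.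
  - apply jpred_letbang; [apply IHt1, hf|]. intros. apply jpred_none.
    apply (hlift _ _ _ _ _ None); auto.
  - apply jpred_tens; [|apply IHt2, hf]. apply jpred_none, IHt1, hf.
  - apply jpred_lettens; [apply IHt1, hf|]. intros. apply (hlift _ _ _ _ _ (Some B)); auto.
  - apply jpred_abort, IHt, hf.
  - apply jpred_inl, IHt, hf.
  - apply jpred_inr, IHt, hf.
  - apply jpred_case; [apply IHt1, hf|apply IHt2, hf|apply IHt3, hf].
  - apply vpred_llam, IHt, hf.
  - apply jpred_lapp; [|apply IHt2, hf]. apply jpred_none, IHt1, hf.
Qed.

(** * Admissible maps at translated types *)

Context (K_und : forall T a (k : etm (lnctx T) (Some (CConst (und a))) R),
  K k <-> definable (s := TConst a) k).
Context (R_id : forall T (k : etm (lnctx T) (Some R) R), cpred k <-> eeq k (EStoup _ R)).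

(** Up to equality the identity is the only admissible map from [R] to [R], so testing against it
    suffices. *)
Lemma vpred_ln_neg T s (t : etm (lnctx T) None (ln_neg und R s)) :
  vpred t <-> cpred (ELApp t (EStoup _ (ln_ty und R s))).
Proof.
  split.
  - intros ht. specialize (ht _ ext_refl _ (proj2 (R_id _) (eeq_refl _))).
    rewrite eext_refl in ht. exact ht.
  - intros ht T' e k hk. apply R_id in hk.
    eapply pred_eeq; [|apply (proj2 pred_ext _ _ _ e _ ht)].
    exact (eeq_stsub1 (eeq_sym hk) (eeq_refl _)).
Qed.

(** By induction on [s]: the clause of [cpred] at [ln_ty s] supplies the subterms of a witness, and
    the eta rule of that type reassembles [k] from them. *)
Lemma cpred_definable s : forall T (k : etm (lnctx T) (Some (ln_ty und R s)) R),
  cpred k <-> definable k.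
Proof.
  induction s as [a| |s1 IH1 s2 IH2|s1 IH1 s2 IH2]; intros T k; simpl.
  - apply K_und.
  - split; auto. intros _. exists (LStar T).
    eapply eeq_trans; [apply eeq_llam_beta|].
    eapply eeq_trans; [apply (eeq_abort_eta (EStoup _ CZero) k)|].
    rewrite stsub1_estoup. apply eeq_refl.
  - rewrite IH1, IH2. split.
    + intros [[M hM] [N hN]]. exists (LPair M N).
      eapply eeq_trans; [apply eeq_llam_beta|]. rewrite <- (stsub1_estoup k).
      eapply eeq_trans; [|apply eeq_case_eta].
      unfold stsub1 at 1. simpl. rewrite !esub_id_none.
      apply eeq_case; auto using eeq_refl.
    + intros [M hM]. split; [exists (LFst M)|exists (LSnd M)];
        (eapply eeq_trans; [apply eeq_llam_beta|]); rewrite stsub1_estoup;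
        (eapply eeq_trans; [|exact (eeq_stsub1 hM (eeq_refl _))]);
        unfold stsub1; simpl; rewrite esub_id_none; apply eeq_refl.
  - split.
    + intros hk.
      (* The implication is instantiated with a fresh variable, admissible because [LVar vz] defines
         it; the term defining the result is the body of the sought abstraction. *)
      destruct (proj1 (IH2 _ _) (hk _ (ext_cons s1 ext_refl) (EVar vz)
        (proj2 (vpred_ln_neg (s := s1) _)
          (proj2 (IH1 _ _) (ex_intro _ (LVar vz) (eeq_refl _)))))) as [M hM].
      exists (LLam M).
      eapply eeq_trans; [apply eeq_llam_beta|]. rewrite <- (stsub1_estoup k).
      eapply eeq_trans; [|apply eeq_lettens_eta].
      rewrite stsub1_estoup. apply eeq_lettens; [apply eeq_refl|exact hM].
    + intros [M hM] T' e a ha. apply vpred_ln_neg, IH1 in ha. destruct ha as [N hN].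
      apply IH2. exists (LApp (lren M (ext_ren e)) N).
      eapply eeq_trans; [apply eeq_llam_beta|]. rewrite stsub1_estoup.
      eapply eeq_trans; [|exact (eeq_stsub1 (eext_eeq e hM) (eeq_refl _))].
      unfold stsub1; simpl. rewrite esub_id_none, ln_tm_eext.
      apply eeq_lapp; [apply eeq_refl|]. apply eeq_tens; [|apply eeq_refl].
      (* Eta for linear abstraction turns an equation between applications into one between
         values. *)
      eapply eeq_trans; [apply eeq_sym, eeq_llam_eta|].
      eapply eeq_trans; [apply eeq_llam, hN|apply eeq_llam_eta].
Qed.

(** Variables are definable, hence admissible, so the fundamental lemma at the identity substitution
    makes [t] admissible and therefore definable. *)
Lemma ln_tm_full T s (t : etm (lnctx T) None (ln_neg und R s)) :
  exists M : tm T s, eeq (ln_tm und R M) t.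
Proof.
  assert (ht : vpred t).
  { rewrite <- (esub_id t). apply jpred_none, jpred_esub.
    apply map_var_case. intros u x. apply vpred_ln_neg, cpred_definable.
    exists (LVar x). apply eeq_refl. }
  apply vpred_ln_neg, cpred_definable in ht. destruct ht as [M hM]. exists M.
  eapply eeq_trans; [apply eeq_sym, eeq_llam_eta|].
  eapply eeq_trans; [apply eeq_llam, hM|apply eeq_llam_eta].
Qed.

End Full.

(** * Fullness for the two choices of [R] *)

Lemma ln_tm_full_const (VK CK LK : Type) (und : LK -> CK)
  (und_inj : forall a b : LK, und a = und b -> a = b) (r : CK) (hr : forall a, r <> und a)
  T s (t : etm (ln_ctx und (CConst r) T) None (ln_neg (VK := VK) und (CConst r) s)) :
  exists M : tm T s, eeq (ln_tm und (CConst r) M) t.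
Proof.
  set (R := CConst r : cty VK CK).
  (* The definable maps, together with the identity at [r]. Since [r] lies outside the range of
     [und], the two alternatives never meet at one constant. *)
  set (K := fun T c (k : etm (ln_ctx und R T) (Some (CConst c)) R) =>
    definable_const k \/
    exists e : r = c,
      eeq k (eq_rect r (fun c => etm (ln_ctx und R T) (Some (CConst c)) R) (EStoup _ R) c e)).
  apply (ln_tm_full (Q := fun _ _ => True) (K := K)); auto.
  - intros T' c k k' h [hk|[e hk]]; [left|right].
    + eapply definable_const_eeq; eassumption.
    + exists e. eapply eeq_trans; [apply eeq_sym, h|exact hk].
  - intros T' T'' e c k [hk|[e' hk]]; [left|right].
    + apply definable_const_eext, hk.
    + destruct e'. exists eq_refl. exact (eext_eeq e hk).
  - intros T' a k. rewrite <- (definable_const_und und_inj). split; [|left; assumption].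
    intros [hk|[e _]]; [exact hk|]. case (hr a e).
  - intros T' k. split.
    + intros [hk|[e hk]].
      * destruct (definable_const_range hk) as [a e]. case (hr a e).
      * rewrite (UIP_refl _ _ e) in hk. exact hk.
    + intros hk. right. exists eq_refl. exact hk.
Qed.

Lemma ln_tm_full_CI (VK CK LK : Type) (und : LK -> CK)
  (und_inj : forall a b : LK, und a = und b -> a = b)
  T s (t : etm (ln_ctx und CI T) None (ln_neg (VK := VK) und CI s)) :
  exists M : tm T s, eeq (ln_tm und CI M) t.
Proof.
  (* With this [Q], a map from [CI] is admissible when it sends top to top. *)
  apply (ln_tm_full (Q := fun T t => eeq t (ETop _))
    (K := fun T c k => definable_const (c := c) k)).
  - intros T' u v h h'. eapply eeq_trans; [apply eeq_sym, h|exact h'].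
  - intros T' T'' e u h. exact (eext_eeq e h).
  - intros T' c k k'. apply definable_const_eeq.
  - intros T' T'' e c k. apply definable_const_eext.
  - intros T' a k. apply definable_const_und, und_inj.
  - intros T' k. simpl. split.
    (* By eta, [k] is a let on its stoup with body [k] at top, that is, top; eta once more
       identifies this let with the stoup itself. *)
    + intros hk. rewrite <- (stsub1_estoup k).
      eapply eeq_trans; [apply eeq_sym, eeq_lettop_eta|].
      eapply eeq_trans; [apply eeq_lettop; [apply eeq_refl|exact hk]|].
      exact (eeq_lettop_eta (EStoup _ CI) (EStoup _ CI)).
    + intros hk. exact (eeq_stsub1 hk (eeq_refl (ETop _))).
Qed.

Theorem theorem4p4 (VK CK LK : Type) (und : LK -> CK)
  (und_inj : forall a b : LK, und a = und b -> a = b)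
  (R : cty VK CK)
  (hR : (exists r : CK, R = CConst r /\ forall a : LK, r <> und a) \/ R = CI) :
  (forall (Theta : list (ty LK)) (tau : ty LK) (M N : tm Theta tau),
      eeq (ln_tm und R M) (ln_tm und R N) -> leq M N) /\
  (forall (Theta : list (ty LK)) (tau : ty LK)
          (t : etm (ln_ctx und R Theta) None (VLolli (ln_ty und R tau) R)),
      exists M : tm Theta tau, eeq (ln_tm und R M) t).
Proof.
  destruct hR as [[r [-> hr]]| ->]; split; intros Theta tau.
  (* The point chosen in the set at [r] is the family that is constantly [True]. *)
  - intros M N. apply (ln_tm_faithful und_inj (R := CConst r) (fun _ _ _ _ => True)).
  - intros t. exact (ln_tm_full_const und_inj hr t).
  - intros M N. apply (ln_tm_faithful und_inj (R := CI) tt).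
  - intros t. exact (ln_tm_full_CI und_inj t).
Qed.
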